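(* Let $\gamma>\frac12$, $T>0$, $t\in[0,T]$, and let $m\ge0$ be an integer. Let $A:\mathcal{L}^2(\mathcal{D})\supset D(A)\to\mathcal{L}^2(\mathcal{D})$ and $Q:\mathcal{L}^2(\mathcal{D})\to\mathcal{L}^2(\mathcal{D})$, with $\mathcal{D}\subset\mathbb{R}^d$, be linear operators such that: $A$ and $Q$ have a joint orthonormal basis of eigenfunctions $\{e_k\}_{k=1}^\infty$ spanning $\mathcal{L}^2(\mathcal{D})$, with real eigenvalues $\{\mu_k\}$ (of $A$, indexed to be non-decreasing in $k$) and $\{\lambda_k\}$ (of $Q$, indexed to be non-increasing in $k$); there are $r_\mu>0$, $C_1>0$ with $\mu_k\ge C_1k^{r_\mu}$; and there are $r_\lambda<0$, $C_2>0$ with $0<\lambda_k\le C_2k^{r_\lambda}$. Assume $1+r_\lambda-(2\gamma-1)r_\mu<0$. Let $\mathcal{I}=\{t_\ell\}_{\ell=0}^N$ with $0=t_0<t_1<\dots<t_N=T$, $h:=\max_\ell(t_\ell-t_{\ell-1})$, and let $\Pi_m:\mathcal{L}^2([0,t))\supset\mathcal{A}\to\mathcal{P}_m(\mathcal{I})$ satisfy: (i) $\Pi_mg=g$ for all $g\in\mathcal{P}_m(\mathcal{I})$; (ii) $\mathcal{B}\subseteq\mathcal{A}$; (iii) there exists $C_\Pi>0$ such that $\|\Pi_m\chi\|_{\mathcal{L}^2([0,t))}\le C_\Pi\|\chi\|_{\mathcal{L}^2([0,t))}$ for all $\chi\in\mathcal{B}$. Let $X(t)$ and $\tilde X^h_M(t)$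 be as in the context. Then $$\mathbb{E}\left[\|X(t)-\tilde X^h_M(t)\|^2\right]\le C'M^{-\frac{2\nu}{d}}+C''_M\,\delta_{\gamma,h}\,h^{\min(2\gamma-1,\,2m+2)},$$ where $\nu=-\frac d2(1+r_\lambda-(2\gamma-1)r_\mu)$, $$C'=\frac{C_2\,\Gamma(2\gamma-1)}{C_1^{2\gamma-1}\,\Gamma(\gamma)^2\,\left((2\gamma-1)r_\mu-r_\lambda-1\right)},\qquad C''_M=C(C_\Pi,t,\gamma)\sum_{k=1}^M\lambda_k,$$ with $C(C_\Pi,t,\gamma)$ depending on $C_\Pi$, $t$ and $\gamma$; and $\delta_{\gamma,h}=1$ when $\gamma\neq m+\frac32$, $\delta_{\gamma,h}=1+\sqrt{\log(th^{-1})}$ when $\gamma=m+\frac32$. If in addition $\gamma>m+\frac32+\frac1q$ for some $q\in[2,\infty)$ and $\|\Pi_m\chi\|_{\mathcal{L}^p([0,t))}\le C_{\Pi,p}\|\chi\|_{\mathcal{L}^p([0,t))}$ for all $\chi\in\mathcal{B}$, where $p\in(2,\infty]$ satisfies $\frac1q+\frac1p=\frac12$, then the bound holds with $C''_M=\frac{C}{\Gamma(\gamma)^2}\sum_{k=1}^M\mu_k^{-\frac2q}\lambda_k$, where $C$ is a constant.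
   Context: $\|\cdot\|$ and $\langle\cdot,\cdot\rangle$ are the norm and inner product of $\mathcal{L}^2(\mathcal{D})$; $\Gamma$ is the gamma function. $W_Q$ is a (generalised) $Q$-Wiener process, $S(t)=\mathrm{e}^{-tA}$ is the $C_0$-semigroup with $S(t)e_k=\mathrm{e}^{-\mu_kt}e_k$, and $X(t)=\frac{1}{\Gamma(\gamma)}\int_0^t(t-s)^{\gamma-1}S(t-s)\,\mathrm{d}W_Q(s)$ for $t\in[0,T]$. Then $X(t)=\sum_{k=1}^\infty c_k(t)e_k$ with $c_k(t)=\frac{\sqrt{\lambda_k}}{\Gamma(\gamma)}\int_0^t\mathrm{e}^{-\mu_k(t-s)}(t-s)^{\gamma-1}\,\mathrm{d}\omega_k(s)$, where $\omega_k(t)=\lambda_k^{-1/2}\langle W_Q(t),e_k\rangle$ are independent real-valued standard Wiener processes. $f_t(s):=(t-s)^{\gamma-1}$ for $s\in[0,t)$. $\mathcal{P}_m(\mathcal{I})$ is the set of $p\in\mathcal{L}^2([0,t))$ whose restriction to each $[t_{\ell-1},t_\ell)$ (within $[0,t)$), $\ell=1,\dots,N$, is a polynomial of order at most $m$. $\mathcal{B}:=\{g+\alpha f_t:\alpha\in\mathbb{R},\ g\in\mathcal{P}_m(\mathcal{I})\}$. For a positive integer $M$, the full discretisation is $\tilde X^h_M(t)=\sum_{k=1}^M\tilde c_k^{(m)}(t)e_k$ with $\tilde c_k^{(m)}(t)=\frac{\sqrt{\lambda_k}}{\Gamma(\gamma)}\int_0^t\mathrm{e}^{-\mu_k(t-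s)}(\Pi_mf_t)(s)\,\mathrm{d}\omega_k(s)$.
   Formalization: The factor δ_{γ,h} is squared in the bound (this matters only for γ = m+3/2, where the first power fails for orthogonal projection on uniform meshes), and Π_m is assumed linear on a subspace 𝒜, without which the bound is false. *)

(* Defs.v *)
From HB Require Import structures.
From mathcomp Require Import all_boot all_order all_algebra.
From mathcomp Require Import all_classical all_reals all_analysis.

Set Implicit Arguments.
Unset Strict Implicit.
Unset Printing Implicit Defensive.
Import Order.TTheory GRing.Theory Num.Def Num.Theory.
Import numFieldNormedType.Exports.
Local Open Scope classical_set_scope.
Local Open Scope ring_scope.

Section tuple_lebesgue.
Variable R : realType.
Notation TR := (measurableTypeR R).

Section step.
Variables (n : nat) (nu : {sigma_finite_measure set (n.-tuple TR) -> \bar R}).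

Definition tuple_cons (p : TR * n.-tuple TR) : n.+1.-tuple TR :=
  [tuple of p.1 :: p.2].

Definition tuple_uncons (x : n.+1.-tuple TR) : TR * n.-tuple TR :=
  (thead x, [tuple of behead x]).

Lemma measurable_tuple_cons : measurable_fun setT tuple_cons.
Proof. exact: (measurable_cons measurable_fst measurable_snd). Qed.

Lemma measurable_tuple_uncons : measurable_fun setT tuple_uncons.
Proof.
apply: measurable_fun_pair; last exact: measurable_behead.
exact: measurable_tnth.
Qed.

Lemma tuple_consK : cancel tuple_cons tuple_uncons.
Proof. by case=> a v; congr pair; apply/val_inj. Qed.

Definition tuple_lebesgueS : set (n.+1.-tuple TR) -> \bar R :=
  pushforward (lebesgue_measure \x nu)%E tuple_cons.

Let tuple_lebesgueS0 : tuple_lebesgueS set0 = 0%E.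
Proof. by rewrite /tuple_lebesgueS /pushforward preimage_set0 measure0. Qed.

Let tuple_lebesgueS_ge0 A : (0 <= tuple_lebesgueS A)%E.
Proof. by rewrite /tuple_lebesgueS /pushforward measure_ge0. Qed.

Let tuple_lebesgueS_sigma_additive : semi_sigma_additive tuple_lebesgueS.
Proof.
move=> F mF tF mUF; rewrite /tuple_lebesgueS /pushforward preimage_bigcup.
have mc A : measurable A -> measurable (tuple_cons @^-1` A).
  by move=> mA; rewrite -[X in measurable X]setTI; exact: measurable_tuple_cons.
apply: measure_semi_sigma_additive.
- by move=> k; exact: mc.
- apply/trivIsetP => /= i j _ _ ij; rewrite -preimage_setI.
  by move/trivIsetP : tF => /(_ _ _ _ _ ij) ->//; rewrite preimage_set0.
- by rewrite -preimage_bigcup; exact: mc.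
Qed.

HB.instance Definition _ := isMeasure.Build _ _ _ tuple_lebesgueS
  tuple_lebesgueS0 tuple_lebesgueS_ge0 tuple_lebesgueS_sigma_additive.

Lemma tuple_lebesgueS_sigma_finite : sigma_finite setT tuple_lebesgueS.
Proof.
pose leb : {sigma_finite_measure set TR -> \bar R} := lebesgue_measure.
have /sigma_finiteP[F [TF ndF Foo]] := sigma_finiteT leb.
have /sigma_finiteP[G [TG ndG Goo]] := sigma_finiteT nu.
exists (fun k => tuple_uncons @^-1` (F k `*` G k)).
  rewrite predeqE => x; split=> // _.
  have [i _ Fi] : (\bigcup_i F i) (tuple_uncons x).1 by rewrite -TF.
  have [j _ Gj] : (\bigcup_i G i) (tuple_uncons x).2 by rewrite -TG.
  exists (maxn i j) => //; split.
  - by move: Fi; exact/subsetPset/ndF/leq_maxl.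
  - by move: Gj; exact/subsetPset/ndG/leq_maxr.
move=> k; have [mF Fk] := Foo k; have [mG Gk] := Goo k; split.
  rewrite -[X in measurable X]setTI; apply: measurable_tuple_uncons => //.
  exact: measurableX.
rewrite /tuple_lebesgueS /pushforward -comp_preimage.
rewrite (_ : _ \o _ = id) ?preimage_id; last exact/funext/tuple_consK.
by rewrite product_measure1E// lte_mul_pinfty// ge0_fin_numE.
Qed.

HB.instance Definition _ :=
  Measure_isSigmaFinite.Build _ _ _ tuple_lebesgueS
    tuple_lebesgueS_sigma_finite.

End step.

(* Lebesgue measure on R^n, as an iterated product of [lebesgue_measure]. *)
Fixpoint tuple_lebesgue (n : nat) :
    {sigma_finite_measure set (n.-tuple TR) -> \bar R} :=
  if n is n'.+1 then tuple_lebesgueS (tuple_lebesgue n')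
  else \d_([tuple]).

End tuple_lebesgue.

(* The elements of L^2(mu) are represented by functions; operators on L^2(mu)
   act on representatives and respect equality almost everywhere. *)
Section L2.
Context d (T : measurableType d) (R : realType).
Variable mu : {measure set T -> \bar R}.
Implicit Types (f g : T -> R) (e : nat -> T -> R) (A : (T -> R) -> T -> R).

Definition L2 : set (T -> R) := [set f | f \in Lfun mu 2%:E].

Definition L2norm f : \bar R := ('N[mu]_2%:E[EFin \o f])%E.

Definition L2dot f g : R := \int[mu]_x (f x * g x).

Definition linear_operator (dom : set (T -> R)) A : Prop :=
  [/\ dom `<=` L2 /\ (forall f, dom f -> L2 (A f)),
      dom (cst 0),
      forall a f g, dom f -> dom g -> dom (fun x => a * f x + g x),
      forall f g, dom f -> L2 g -> f = g %[ae mu] ->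
        dom g /\ A f = A g %[ae mu] &
      forall a f g, dom f -> dom g ->
        A (fun x => a * f x + g x) = (fun x => a * A f x + A g x) %[ae mu]].

Definition orthonormal_basis e : Prop :=
  [/\ forall k, L2 (e k),
      forall j k, L2dot (e j) (e k) = (j == k)%:R &
      forall f, L2 f ->
        L2norm (fun x => f x - \sum_(k < n) L2dot f (e k) * e k x)
          @[n --> \oo] --> 0%E].

Definition eigenfunction (dom : set (T -> R)) A (a : R) f : Prop :=
  dom f /\ A f = (fun x => a * f x) %[ae mu].

End L2.

Section wiener.
Context dO (Omega : measurableType dO) (R : realType).
Variable P : probability Omega R.

(* N(0, v); [normal_prob] with standard deviation 0 is not a Dirac measure. *)
Definition centered_normal (v : R) : set R -> \bar R :=
  if v == 0 then \d_(0 : R) else normal_prob 0 (Num.sqrt v).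

Definition independent_rvs n (X : 'I_n -> Omega -> R) : Prop :=
  forall B : 'I_n -> set R, (forall i, measurable (B i)) ->
    fine (P (\bigcap_(i in [set: 'I_n]) (X i @^-1` B i))) =
    \prod_(i < n) fine (P (X i @^-1` B i)).

(* W s phi is the real random variable <W(s), phi>, which is all that exists of
   W(s) when Q is not of trace class.  As W is linear in phi, independence of
   the increments tested against arbitrary phi i is independence of the
   sigma-algebras generated by the increments. *)
Definition generalised_wiener d (T : measurableType d)
    (mu : {measure set T -> \bar R}) (Q : (T -> R) -> T -> R)
    (W : R -> (T -> R) -> {RV P >-> R}) : Prop :=
  [/\ forall s a phi psi, 0 <= s -> L2 mu phi -> L2 mu psi ->
        {ae P, forall w,
          W s (fun x => a * phi x + psi x) w = a * W s phi w + W s psi w},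
      forall phi, L2 mu phi -> {ae P, forall w, W 0 phi w = 0},
      forall phi, L2 mu phi ->
        {ae P, forall w, {within `[0, +oo[, continuous (fun s => W s phi w)}},
      forall s r phi, 0 <= s -> s < r -> L2 mu phi ->
        forall B, measurable B ->
          P [set w | B (W r phi w - W s phi w)] =
          centered_normal ((r - s) * L2dot mu (Q phi) phi) B &
      forall n (s : nat -> R) (phi : 'I_n -> T -> R),
        0 <= s 0%N -> (forall i, (i < n)%N -> s i <= s i.+1) ->
        (forall i, L2 mu (phi i)) ->
        independent_rvs
          (fun (i : 'I_n) w => W (s i.+1) (phi i) w - W (s i) (phi i) w)].

Definition step_fun n (s a : nat -> R) (x : R) : R :=
  \sum_(i < n) a i * \1_`[s i, s i.+1[ x.

Definition step_integral (B : R -> Omega -> R) n (s a : nat -> R) (w : Omega)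
    : R :=
  \sum_(i < n) a i * (B (s i.+1) w - B (s i) w).

Definition leb_upto (t : R) : {measure set (measurableTypeR R) -> \bar R} :=
  mrestr lebesgue_measure (measurable_itv `[0, t[).

(* I is (a version of) int_0^t f dB: the limit in L^2(P) of the integrals of
   step functions converging to f in L^2([0, t)). *)
Definition is_wiener_integral (B : R -> Omega -> R) (t : R) (f : R -> R)
    (I : Omega -> R) : Prop :=
  [/\ L2 (leb_upto t) f, L2 P I &
    exists (n : nat -> nat) (s a : nat -> nat -> R),
      [/\ forall j, 0 <= s j 0%N /\ s j (n j) <= t,
          forall j i, (i < n j)%N -> s j i <= s j i.+1,
          L2norm (leb_upto t) (fun x => step_fun (n j) (s j) (a j) x - f x)
            @[j --> \oo] --> 0%E &
          L2norm P (fun w => step_integral B (n j) (s j) (a j) w - I w)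
            @[j --> \oo] --> 0%E]].

Definition mean_sq_norm d (T : measurableType d)
    (mu : {measure set T -> \bar R}) (Y : Omega -> T -> R) : \bar R :=
  ('E_P[(fun w => fine (L2norm mu (Y w)) ^+ 2)%R])%E.

(* X is an L^2(mu)-valued random variable equal to sum_k c_k e_k, where the
   series converges in L^2(Omega; L^2(mu)). *)
Definition is_L2_series d (T : measurableType d)
    (mu : {measure set T -> \bar R}) (c : nat -> Omega -> R)
    (e : nat -> T -> R) (X : Omega -> T -> R) : Prop :=
  [/\ forall w, L2 mu (X w),
      forall phi, L2 mu phi ->
        measurable_fun setT (fun w => L2dot mu (X w) phi) &
      mean_sq_norm mu (fun w x => X w x - \sum_(k < n) c k w * e k x)
        @[n --> \oo] --> 0%E].

End wiener.

Section rates.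
Variable R : realType.
Implicit Types (x gamma t h : R) (m N : nat) (tau : nat -> R).

Definition Gamma x : R :=
  \int[lebesgue_measure]_(s in `]0, +oo[) (s `^ (x - 1) * expR (- s)).

Definition power_kernel gamma t : R -> R := fun s => (t - s) `^ (gamma - 1).

Definition mesh T N tau : Prop :=
  [/\ tau 0%N = 0, tau N = T & forall l, (l < N)%N -> tau l < tau l.+1].

Definition mesh_size N tau : R := \big[Num.max/0]_(l < N) (tau l.+1 - tau l).

(* Piecewise polynomials of degree at most m ([size p <= m.+1]). *)
Definition piecewise_poly t m N tau : set (R -> R) :=
  [set p | L2 (leb_upto t) p /\
    forall l, (l < N)%N -> exists2 q : {poly R}, (size q <= m.+1)%N &
      {ae lebesgue_measure, forall s,
        tau l <= s < tau l.+1 -> 0 <= s < t -> p s = q.[s]}].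

Definition approx_space gamma t m N tau : set (R -> R) :=
  [set chi | exists2 g, piecewise_poly t m N tau g &
    exists a : R, chi = (fun s => g s + a * power_kernel gamma t s)].

(* [Num.sqrt] vanishes on negative numbers: this is 1 when t < h.
   delta is the factor in the bound on the L^2([0, t)) norm of the projection
   error of [power_kernel], hence it is squared in a mean-square bound: for
   gamma = m + 3/2 and the orthogonal projection on a uniform mesh, the squared
   norm of that error is of exact order log(t / h) * h ^ (2 m + 2). *)
Definition delta gamma m t h : R :=
  if gamma == m%:R + 3 / 2 then 1 + Num.sqrt (ln (t / h)) else 1.

End rates.

(* Main.v *)
(** By Parseval's identity and the isometry of the Wiener integral, the error is
    the sum over k < M of lambda_k / Gamma(gamma)^2 times the squared norm of
    e^{-mu_k (t - s)} (f_t - Pi f_t) on [0, t), plus the sum over k >= M of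
    lambda_k / Gamma(gamma)^2 times that of e^{-mu_k (t - s)} f_t.  The latter is
    at most Gamma(2 gamma - 1) mu_k^{1 - 2 gamma}, so the tail is bounded by an
    integral of a power of k.

    For the former, f_t - Pi f_t = (f_t - g) - Pi (f_t - g) for every piecewise
    polynomial g, so by stability it suffices to approximate f_t.  On mesh
    intervals at distance at least h from t, a polynomial of degree m reaches
    accuracy h^{m+1} (t - s)^{gamma - m - 2}; on the others take g = 0.  Both errors
    are bounded by the minimum of (t - s)^{gamma - 1} and
    h^{m+1} (t - s)^{gamma - m - 2}, whose square integrates to the stated power of
    h, with a logarithm exactly when 2 gamma - 1 = 2 m + 2.  Under the additional
    assumption on gamma, Hoelder's inequality moves the exponential weight to
    L^q, where it contributes mu_k^{-2/q}, and the second profile has finite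
    L^p norm. *)

Require Import Defs.
From mathcomp Require Import all_boot all_order all_algebra.
From mathcomp Require Import all_classical all_reals all_analysis.
From mathcomp Require Import measurable_realfun ess_sup_inf ring lra.

Set Implicit Arguments.
Unset Strict Implicit.
Unset Printing Implicit Defensive.
Import Order.TTheory GRing.Theory Num.Def Num.Theory.
Import numFieldNormedType.Exports.
Local Open Scope classical_set_scope.
Local Open Scope ring_scope.

(** * Square-integrable functions and orthonormal series *)

(** The constants have to be chosen before the mesh, the projection and the processes. Hence the two
    approximation results for the kernel quantify their constant ahead of [T], [N] and [tau], and
    the final constants are read off from them as functions of [t], [gamma] and, for the second
    bound, [m] and [q]. The threshold [h] is natural because, in the variable [x = t - s], a mesh
    interval [[a, b]] with [h <= a] satisfies [b <= 2 * a], so each power of [x] varies on it by a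
    bounded factor only. The other intervals lie in [x <= 2 * h], where both candidate bounds are at
    least a fixed fraction of the kernel itself. A Wiener integral is given only as a limit along
    some sequence of step functions, and the sequences for the two integrands are unrelated. The
    isometry is therefore an equality of inner products of step functions on two arbitrary
    partitions. It rests on the increments of the process in [L^2(P)] having the same covariances as
    those of [x |-> 1_[0, x[] in [L^2([0, t))]. *)

Section L2_space.
Context d (T : measurableType d) (R : realType).
Variable mu : {measure set T -> \bar R}.
Implicit Types (f g h : T -> R).

Lemma L2_measurable f : L2 mu f -> measurable_fun setT f.
Proof. by rewrite /L2/= inE => /andP[]; rewrite inE. Qed.

Lemma integral_sqr_abs f :
  (\int[mu]_x (`|f x| `^ 2)%:E = \int[mu]_x (f x ^+ 2)%:E)%E.
Proof.
by apply: eq_integral => x _; rewrite powR_mulrn// real_normK// num_real.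
Qed.

Lemma L2normE f : (L2norm mu f = (\int[mu]_x (f x ^+ 2)%:E) `^ 2^-1)%E.
Proof.
rewrite /L2norm unlock; congr (_ `^ _)%E; rewrite -integral_sqr_abs.
by apply: eq_integral.
Qed.

Lemma integral_sqr_ge0 f : (0 <= \int[mu]_x (f x ^+ 2)%:E)%E.
Proof. by apply: integral_ge0 => x _; rewrite lee_fin sqr_ge0. Qed.

Lemma L2norm_sqr f : (L2norm mu f * L2norm mu f = \int[mu]_x (f x ^+ 2)%:E)%E.
Proof.
have h : 2^-1 + 2^-1 = 1 :> R by lra.
rewrite L2normE -poweRD ?h ?poweRe1 ?integral_sqr_ge0//.
by apply: add_neq0_poweRD_def; rewrite h oner_neq0.
Qed.

Lemma L2P f : L2 mu f <->
  measurable_fun setT f /\ (\int[mu]_x (f x ^+ 2)%:E < +oo)%E.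
Proof.
split=> [L2f|[mf fi]].
  split; first exact: L2_measurable.
  have /integrableP[_] := Lfun2_integrable_sqr L2f.
  by under eq_integral do rewrite /= ger0_norm ?sqr_ge0//.
rewrite /L2/= inE; apply/andP; split; rewrite inE//= /finite_norm.
by rewrite -/(L2norm mu f) L2normE poweR_lty.
Qed.

Lemma L2D f g : L2 mu f -> L2 mu g -> L2 mu (fun x => f x + g x).
Proof.
rewrite /L2/= => Lf Lg.
have := Lfun_addr_closed mu (lee1n 2); case=> _ /(_ _ _ Lf Lg); exact.
Qed.

Lemma L2Z a f : L2 mu f -> L2 mu (fun x => a * f x).
Proof.
move=> Lf; have := @Lfun_scale _ _ _ mu f a 2 _ Lf; rewrite ler1n => /(_ isT).
by congr (L2 mu _); apply/funext => x; rewrite /= mulrC.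
Qed.

Lemma L2N f : L2 mu f -> L2 mu (fun x => - f x).
Proof.
move=> Lf; rewrite (_ : (fun x => - f x) = fun x => -1 * f x).
  exact: L2Z.
by apply/funext => x; rewrite mulN1r.
Qed.

Lemma L2B f g : L2 mu f -> L2 mu g -> L2 mu (fun x => f x - g x).
Proof. by move=> Lf Lg; apply: L2D => //; exact: L2N. Qed.

Lemma L20 : L2 mu (fun=> 0).
Proof.
apply/L2P; split => //.
by under eq_integral do rewrite expr0n/=; rewrite integral0 ltry.
Qed.

Lemma L2_sum n (f : nat -> T -> R) (a : nat -> R) :
  (forall i, (i < n)%N -> L2 mu (f i)) ->
  L2 mu (fun x => \sum_(i < n) a i * f i x).
Proof.
elim: n => [|n IH] Lf.
  rewrite (_ : (fun _ => _) = fun=> 0); first exact: L20.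
  by apply/funext => x; rewrite big_ord0.
rewrite (_ : (fun _ => _) =
    fun x => (\sum_(i < n) a i * f i x) + a n * f n x).
  apply: L2D; first by apply: IH => i ni; apply: Lf; rewrite ltnS ltnW.
  by apply: L2Z; exact: Lf.
by apply/funext => x; rewrite big_ord_recr.
Qed.

Lemma L2_integrableM f g : L2 mu f -> L2 mu g ->
  mu.-integrable setT (EFin \o (fun x => f x * g x)).
Proof. by move=> Lf Lg; apply/Lfun1_integrable; exact: Lfun2_mul_Lfun1. Qed.

Lemma L2dotC f g : L2dot mu f g = L2dot mu g f.
Proof. by apply: eq_Rintegral => x _; rewrite mulrC. Qed.

Lemma L2dotDl f g h : L2 mu f -> L2 mu g -> L2 mu h ->
  L2dot mu (fun x => f x + g x) h = L2dot mu f h + L2dot mu g h.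
Proof.
move=> Lf Lg Lh; rewrite /L2dot -RintegralD//; try exact: L2_integrableM.
by apply: eq_Rintegral => x _; rewrite mulrDl.
Qed.

Lemma L2dotZl a f g : L2 mu f -> L2 mu g ->
  L2dot mu (fun x => a * f x) g = a * L2dot mu f g.
Proof.
move=> Lf Lg; rewrite /L2dot -RintegralZl//; last exact: L2_integrableM.
by apply: eq_Rintegral => x _; rewrite mulrA.
Qed.

Lemma L2dotBl f g h : L2 mu f -> L2 mu g -> L2 mu h ->
  L2dot mu (fun x => f x - g x) h = L2dot mu f h - L2dot mu g h.
Proof.
move=> Lf Lg Lh; rewrite L2dotDl//; last exact: L2N.
congr (_ + _); rewrite -mulN1r -L2dotZl//.
by congr (L2dot mu _ h); apply/funext => x; rewrite mulN1r.
Qed.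

Lemma L2dotBr f g h : L2 mu f -> L2 mu g -> L2 mu h ->
  L2dot mu h (fun x => f x - g x) = L2dot mu h f - L2dot mu h g.
Proof. by move=> Lf Lg Lh; rewrite L2dotC L2dotBl// !(L2dotC h). Qed.

Lemma L2dot_suml n (f : nat -> T -> R) (a : nat -> R) g :
  (forall i, (i < n)%N -> L2 mu (f i)) -> L2 mu g ->
  L2dot mu (fun x => \sum_(i < n) a i * f i x) g =
  \sum_(i < n) a i * L2dot mu (f i) g.
Proof.
move=> + Lg; elim: n => [|n IH] Lf.
  rewrite big_ord0 /L2dot; under eq_Rintegral do rewrite big_ord0 mul0r.
  by rewrite Rintegral_cst ?mul0r.
have Lf' i : (i < n)%N -> L2 mu (f i) by move=> ni; apply: Lf; rewrite ltnS ltnW.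
rewrite big_ord_recr/= -IH// -L2dotZl//; last exact: Lf.
rewrite -L2dotDl//; last 2 first.
- exact: L2_sum.
- by apply: L2Z; exact: Lf.
by congr (L2dot mu _ g); apply/funext => x; rewrite big_ord_recr.
Qed.

Lemma L2dot_self f : L2 mu f ->
  ((L2dot mu f f)%:E = \int[mu]_x (f x ^+ 2)%:E)%E.
Proof.
move=> Lf; rewrite /L2dot /Rintegral fineK; last first.
  by apply: integrable_fin_num => //; exact: L2_integrableM.
by apply: eq_integral => x _; rewrite expr2.
Qed.

Lemma L2dot_ge0 f : 0 <= L2dot mu f f.
Proof. by apply: Rintegral_ge0 => x _; rewrite -expr2 sqr_ge0. Qed.

Lemma L2norm_sqrt f : L2 mu f -> (L2norm mu f = (Num.sqrt (L2dot mu f f))%:E)%E.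
Proof.
by move=> Lf; rewrite L2normE -L2dot_self// poweR_EFin powR12_sqrt// L2dot_ge0.
Qed.

Lemma L2norm_fin_num f : L2 mu f -> L2norm mu f \is a fin_num.
Proof. by move=> Lf; rewrite L2norm_sqrt. Qed.

Lemma fine_L2norm_sqr f : L2 mu f -> fine (L2norm mu f) ^+ 2 = L2dot mu f f.
Proof. by move=> Lf; rewrite L2norm_sqrt//= sqr_sqrtr// L2dot_ge0. Qed.

Lemma L2normD f g : measurable_fun setT f -> measurable_fun setT g ->
  (L2norm mu (fun x => f x + g x)%R <= L2norm mu f + L2norm mu g)%E.
Proof. by move=> mf mg; apply: eminkowski => //; rewrite lee1n. Qed.

Lemma L2normN f : (L2norm mu (fun x => - f x)%R = L2norm mu f)%E.
Proof.
rewrite !L2normE; congr (_ `^ _)%E; apply: eq_integral => x _.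
by rewrite sqrrN.
Qed.

Lemma L2norm_sub f g : (L2norm mu (fun x => f x - g x)%R =
  L2norm mu (fun x => g x - f x)%R)%E.
Proof.
by rewrite -L2normN; congr L2norm; apply/funext => x; rewrite opprB.
Qed.

Lemma L2norm_ge0 f : (0 <= L2norm mu f)%E.
Proof. exact: Lnorm_ge0. Qed.

End L2_space.

Section Parseval.
Context d (T : measurableType d) (R : realType).
Variable mu : {measure set T -> \bar R}.
Variable e : nat -> T -> R.
Hypothesis onb : orthonormal_basis mu e.
Implicit Types (f : T -> R).

Lemma L2_basis k : L2 mu (e k).
Proof. by case: onb. Qed.

Lemma L2dot_basis j k : L2dot mu (e j) (e k) = (j == k)%:R.
Proof. by case: onb. Qed.

Lemma L2dot_sum_basis n (a : nat -> R) k :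
  L2dot mu (fun x => \sum_(i < n) a i * e i x) (e k) = (k < n)%:R * a k.
Proof.
rewrite L2dot_suml//; try by move=> *; exact: L2_basis.
  under eq_bigr do rewrite L2dot_basis.
  case: ltnP => kn.
    rewrite (bigD1 (Ordinal kn))//= eqxx mulr1 mul1r big1 ?addr0// => i ik.
    rewrite (_ : (_ == _) = false) ?mulr0//.
    by apply/negbTE; apply: contra ik => /eqP ik; apply/eqP/val_inj.
  rewrite mul0r big1// => i _; rewrite (_ : (_ == _) = false) ?mulr0//.
  by apply/negbTE; rewrite neq_ltn (leq_trans (ltn_ord i) kn).
Qed.

Lemma L2_sum_basis n (a : nat -> R) :
  L2 mu (fun x => \sum_(i < n) a i * e i x).
Proof. by apply: L2_sum => i _; exact: L2_basis. Qed.

(** For the projection [S] of [f], orthonormality makes [<S, f>] and [<S, S>] both equal to the sum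
    of squared coefficients, so the cross terms collapse. *)
Lemma L2dot_sub_proj f n : L2 mu f ->
  let r := fun x => f x - \sum_(i < n) L2dot mu f (e i) * e i x in
  L2dot mu r r = L2dot mu f f - \sum_(i < n) L2dot mu f (e i) ^+ 2.
Proof.
move=> Lf r; pose S x := \sum_(i < n) L2dot mu f (e i) * e i x.
have LS : L2 mu S by exact: (L2_sum_basis _ (fun i => L2dot mu f (e i))).
have Lr : L2 mu r by exact: L2B.
have SE g : L2 mu g -> L2dot mu S g = \sum_(i < n) L2dot mu f (e i) * L2dot mu (e i) g.
  move=> Lg; rewrite /S (@L2dot_suml _ _ _ mu n e (fun i => L2dot mu f (e i)))//.
  by move=> i _; exact: L2_basis.
have fS : L2dot mu S f = \sum_(i < n) L2dot mu f (e i) ^+ 2.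
  by rewrite SE//; apply: eq_bigr => i _; rewrite L2dotC expr2.
have SS : L2dot mu S S = \sum_(i < n) L2dot mu f (e i) ^+ 2.
  rewrite SE//; apply: eq_bigr => i _.
  rewrite (L2dotC mu (e i)) (L2dot_sum_basis _ (fun i => L2dot mu f (e i))).
  by rewrite ltn_ord mul1r expr2.
rewrite /r -/S (@L2dotBl _ _ _ _ f S)// !L2dotBr// SS (L2dotC mu f S) fS.
by rewrite subrr subr0.
Qed.

(** The defect of the [n]-th partial sum is the squared norm of the remainder, which tends to 0 by
    completeness of the basis. *)
Lemma Parseval f : L2 mu f ->
  ((L2dot mu f f)%:E = \sum_(0 <= k <oo) (L2dot mu f (e k) ^+ 2)%:E)%E.
Proof.
move=> Lf; have [_ _ /(_ f Lf) cv] := onb.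
apply/esym/cvg_lim => //.
pose D n := L2dot mu f f - \sum_(i < n) L2dot mu f (e i) ^+ 2.
have LS n : L2 mu (fun x => f x - \sum_(i < n) L2dot mu f (e i) * e i x).
  by apply: L2B => //; exact: (L2_sum_basis _ (fun i => L2dot mu f (e i))).
have D0 : D n @[n --> \oo] --> (0 : R).
  (* Completeness speaks of norms, that is of [sqrt (D n)]; the defect is recovered as a product of
     two null sequences. *)
  rewrite (_ : D = (fun n => Num.sqrt (D n) * Num.sqrt (D n))); last first.
    apply/funext => n; rewrite -expr2 sqr_sqrtr// /D -L2dot_sub_proj//.
    exact: L2dot_ge0.
  rewrite -[X in _ --> X](mulr0 (0:R)).
  suff h : Num.sqrt (D n) @[n --> \oo] --> (0 : R) by exact: cvgM.
  apply: (@fine_cvg _ _ _ _ (fun n => (Num.sqrt (D n))%:E) 0).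
  apply: cvg_trans cv; apply: near_eq_cvg; near=> n.
  by rewrite L2norm_sqrt// L2dot_sub_proj.
rewrite (_ : (fun n => _) = EFin \o (fun n => L2dot mu f f - D n)); last first.
  apply/funext => n /=; rewrite /D opprB addrC subrK big_mkord.
  by rewrite sumEFin.
apply/cvg_EFin; first by near=> n.
rewrite -[X in _ --> X](subr0 (L2dot mu f f)).
by apply: cvgB => //; exact: cvg_cst.
Unshelve. all: by end_near. Qed.

End Parseval.

Section series_error.
Context d (T : measurableType d) (R : realType).
Variable mu : {measure set T -> \bar R}.
Variable e : nat -> T -> R.
Hypothesis onb : orthonormal_basis mu e.
Context dO (Omega : measurableType dO).
Variable P : probability Omega R.
Variable X : Omega -> T -> R.
Hypothesis L2X : forall w, L2 mu (X w).
Hypothesis mX : forall phi, L2 mu phi ->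
  measurable_fun setT (fun w => L2dot mu (X w) phi).

Let mXe k := mX (L2_basis onb k).

(** Parseval is applied for each fixed [w], then Tonelli exchanges the series with the expectation.
    The factor [(k < n)%:R] lets truncated and untruncated modes share one formula. *)
Lemma mean_sq_norm_sub_partial_sum n (c : nat -> Omega -> R) :
  (forall k, measurable_fun setT (c k)) ->
  (mean_sq_norm P mu (fun w x => X w x - \sum_(k < n) c k w * e k x)%R =
   \sum_(0 <= k <oo)
     \int[P]_w ((L2dot mu (X w) (e k) - (k < n)%:R * c k w) ^+ 2)%:E)%E.
Proof.
move=> mc; rewrite /mean_sq_norm unlock.
pose Y w x := X w x - \sum_(k < n) c k w * e k x.
have LY w : L2 mu (Y w).
  by apply: L2B => //; exact: (L2_sum_basis onb _ (fun k => c k w)).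
rewrite -integral_nneseries//; last 2 first.
- move=> k; apply/measurable_EFinP; apply: measurable_funX.
  by apply: measurable_funB => //; exact: measurable_funM.
- by move=> k w _; rewrite lee_fin sqr_ge0.
apply: eq_integral => w _.
rewrite (fine_L2norm_sqr (LY w)) (Parseval onb)//.
apply: eq_eseriesr => k _; congr ((_ ^+ 2)%:E).
rewrite L2dotBl//; last 2 first.
- exact: (L2_sum_basis onb _ (fun k => c k w)).
- exact: (L2_basis onb).
by rewrite (L2dot_sum_basis onb _ (fun k => c k w)).
Qed.

Lemma integral_sqr0_ae_eq (f g : Omega -> R) :
  measurable_fun setT f -> measurable_fun setT g ->
  (\int[P]_w ((f w - g w) ^+ 2)%:E <= 0)%E -> {ae P, forall w, f w = g w}.
Proof.
move=> mf mg h.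
have mfg : measurable_fun setT (fun w => ((f w - g w) ^+ 2)%:E).
  by apply/measurable_EFinP/measurable_funX/measurable_funB.
have /(ae_eq_integral_abs _ measurableT mfg) :
    (\int[P]_w `|((f w - g w) ^+ 2)%:E| = 0)%E.
  apply/eqP; rewrite eq_le integral_ge0// andbT; apply: le_trans h.
  by under eq_integral do rewrite abse_EFin ger0_norm ?sqr_ge0//.
apply: filterS => w /(_ I) [] /eqP.
by rewrite sqrf_eq0 subr_eq0 => /eqP.
Qed.

(** The expansion of [X] is known only in mean square, so its coordinates must first be identified
    with the [c k] almost surely: the [k]-th squared discrepancy is one term of the error of every
    partial sum with [n > k], and that error tends to 0. *)
Lemma L2_series_error (c c' : nat -> Omega -> R) M :
  (forall k, measurable_fun setT (c k)) ->
  (forall k, measurable_fun setT (c' k)) ->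
  is_L2_series P mu c e X ->
  (mean_sq_norm P mu (fun w x => X w x - \sum_(k < M) c' k w * e k x)%R =
   \sum_(0 <= k <oo) \int[P]_w ((c k w - (k < M)%:R * c' k w) ^+ 2)%:E)%E.
Proof.
move=> mc mc' [_ _ cv].
have cE k : {ae P, forall w, L2dot mu (X w) (e k) = c k w}.
  apply: integral_sqr0_ae_eq => //; rewrite -(cvg_lim _ cv)//.
  apply: lime_ge; first by apply/cvg_ex; exists 0%E.
  near=> n; rewrite mean_sq_norm_sub_partial_sum//.
  have kn : (k < n)%N by near: n; exact: nbhs_infty_gt.
  apply: le_trans (nneseries_lim_ge k.+1 _); last first.
    by move=> i _ _; exact: integral_sqr_ge0.
  have k1 : (k < n)%:R = 1 :> R by rewrite kn.
  rewrite big_nat_recr//= k1; under [X in (_ <= _ + X)%E]eq_integral do rewrite mul1r.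
  by rewrite leeDr// sume_ge0// => i _; exact: integral_sqr_ge0.
rewrite mean_sq_norm_sub_partial_sum//; apply: eq_eseriesr => k _.
apply: ae_eq_integral => //.
- apply/measurable_EFinP; apply: measurable_funX.
  by apply: measurable_funB => //; exact: measurable_funM.
- apply/measurable_EFinP; apply: measurable_funX.
  by apply: measurable_funB => //; exact: measurable_funM.
- by apply: filterS (cE k) => w -> _.
Unshelve. all: by end_near. Qed.

End series_error.

(** * The second moment of a Gaussian *)

Section calculus.
Variable R : realType.
Implicit Types (f F : R -> R).

(** Asking for a two-sided derivative at the endpoints too replaces all one-sided conditions; the
    primitives used below are differentiable there. *)
Lemma FTC2 f F (a b : R) : a < b ->
  (forall x, a <= x <= b -> is_derive x 1 F (f x)) ->
  (forall x, a <= x <= b -> {for x, continuous f}) ->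
  (\int[lebesgue_measure]_(x in `[a, b]) (f x)%:E = (F b - F a)%:E)%E.
Proof.
move=> ab dF cf.
have cF x : a <= x <= b -> {for x, continuous F}.
  by move=> /dF dFx; apply/differentiable_continuous/derivable1_diffP.
rewrite EFinB; apply: continuous_FTC2 => //.
- apply/subspace_continuousP => x /=; rewrite in_itv/= => xab.
  by apply: cvg_within_filter; exact: cf.
- split.
  + by move=> x; rewrite in_itv/= => /andP[/ltW ax /ltW xb]; apply: ex_derive; apply: dF; rewrite ax.
  + by apply: cvg_at_right_filter; apply: cF; rewrite lexx ltW.
  + by apply: cvg_at_left_filter; apply: cF; rewrite lexx ltW.
- move=> x; rewrite in_itv/= => /andP[/ltW ax /ltW xb].
  have [|_ dE] := dF x; first by rewrite ax.
  by rewrite derive1E dE.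
Qed.

Lemma ge0_FTC2y f F (a l : R) :
  (forall x, a <= x -> 0 <= f x) ->
  (forall x, a <= x -> is_derive x 1 F (f x)) ->
  (forall x, a <= x -> {for x, continuous f}) ->
  F x @[x --> +oo] --> l ->
  (\int[lebesgue_measure]_(x in `[a, +oo[) (f x)%:E = (l - F a)%:E)%E.
Proof.
move=> f0 dF cf Fl; rewrite EFinB; apply: ge0_continuous_FTC2y => //.
- apply/subspace_continuousP => x /=; rewrite in_itv/= andbT => ax.
  by apply: cvg_within_filter; exact: cf.
- by move=> x /ltW ax; apply: ex_derive; exact: dF.
- apply: cvg_at_right_filter.
  by apply/differentiable_continuous/derivable1_diffP; apply: ex_derive; exact: dF.
- move=> x; rewrite in_itv/= andbT => /ltW ax.
  by rewrite derive1E; have [_ ->] := dF x ax.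
Qed.

End calculus.

Section normal_second_moment.
Variables (R : realType) (s : R).
Hypothesis s0 : 0 < s.
Let g (x : R) := expR (- (x ^+ 2 / (s ^+ 2 *+ 2))).
Let e (x : R) := expR (- (x / s)).
Let K : R := expR 2^-1.

Let dg (x : R) : is_derive x 1 g (- (x / s ^+ 2) * g x).
Proof.
have -> : - (x / s ^+ 2) * g x = g x * (- ((x *+ 2) / (s ^+ 2 *+ 2))).
  by rewrite mulrC; congr (_ * - _); field; rewrite gt_eqF.
apply: (is_derive1_comp (f := expR) (g := fun x => - (x ^+ 2 / (s ^+ 2 *+ 2)))).
apply: is_deriveN.
have -> : (fun y : R => y ^+ 2 / (s ^+ 2 *+ 2)) = (s ^+ 2 *+ 2)^-1 \*: (id ^+ 2 : R -> R).
  by apply/funext => y; rewrite /= mulrC.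
by apply: is_derive_eq; rewrite /= /GRing.scale/=; ring.
Qed.

Let de (x : R) : is_derive x 1 e (- s^-1 * e x).
Proof.
rewrite mulrC.
apply: (is_derive1_comp (f := expR) (g := fun x => - (x / s))).
apply: is_deriveN.
have -> : (fun y : R => y / s) = s^-1 \*: (id : R -> R).
  by apply/funext => y; rewrite /= mulrC.
by apply: is_derive_eq; rewrite /= /GRing.scale/= mulr1.
Qed.

(** Expanding [(x / s - 1)^2 >= 0] gives [x / s <= (x / s)^2 / 2 + 1 / 2], whence the value
    [K = e^(1/2)]. *)
Let g_le_e x : g x <= K * e x.
Proof.
rewrite /g /K /e -expRD ler_expR.
have -> : x ^+ 2 / (s ^+ 2 *+ 2) = (x / s) ^+ 2 / 2.
  by field; rewrite gt_eqF.
have := sqr_ge0 (x / s - 1); rewrite sqrrB expr1n mulr1; lra.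
Qed.

Let e_cvg0 : e x @[x --> +oo] --> 0.
Proof.
apply: (@cvg_comp _ _ _ (fun x => x / s) (fun x => expR (- x)) _ (pinfty_nbhs R)).
  by apply: gt0_cvgMly => //; rewrite invr_gt0.
exact: cvgr_expR.
Qed.

(** From [1 + y <= e^y] with [y = x^2 / (2 s^2)], [x * g x] is at most [2 s^2 / x]. *)
Let xg_cvg0 : x * g x @[x --> +oo] --> 0.
Proof.
apply: (@squeeze_cvgr _ _ _ _ (cst 0) (fun x => (s ^+ 2 *+ 2) / x)).
- near=> x; have x0 : 0 < x by near: x; exact: nbhs_pinfty_gt.
  apply/andP; split; first by apply: mulr_ge0; [exact: ltW|exact: expR_ge0].
  rewrite ler_pdivlMr// mulrAC -expr2 /g expRN.
  rewrite ler_pdivrMr ?expR_gt0//.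
  have s20 : 0 < s ^+ 2 *+ 2 by rewrite mulrn_wgt0// exprn_gt0.
  have := expR_ge1Dx (x ^+ 2 / (s ^+ 2 *+ 2)).
  rewrite -(ler_pM2l s20); apply: le_trans.
  by rewrite mulrDr mulr1 mulrCA divff ?gt_eqF// mulr1 lerDr ltW.
- exact: cvg_cst.
- rewrite -[X in _ --> X](mulr0 (s ^+ 2 *+ 2)); apply: cvgM; first exact: cvg_cst.
  apply/gtr0_cvgV0; last exact: cvg_id.
  by near=> x; near: x; exact: nbhs_pinfty_gt.
Unshelve. all: by end_near. Qed.

Let cg : continuous g.
Proof. by move=> x; apply/differentiable_continuous/derivable1_diffP; apply: ex_derive. Qed.

Let ce : continuous e.
Proof. by move=> x; apply/differentiable_continuous/derivable1_diffP; apply: ex_derive. Qed.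

Let f (x : R) := x ^+ 2 / s ^+ 2 * g x.

Let f0 x : 0 <= f x.
Proof. by rewrite mulr_ge0 ?expR_ge0// mulr_ge0 ?sqr_ge0 ?invr_ge0 ?sqr_ge0. Qed.

Let cf : continuous f.
Proof.
move=> x; apply: cvgM; last exact: cg.
by apply: cvgM; [exact: exprn_continuous|exact: cvg_cst].
Qed.

Let mg : measurable_fun setT g. Proof. exact: continuous_measurable_fun. Qed.
Let me : measurable_fun setT e. Proof. exact: continuous_measurable_fun. Qed.
Let mf : measurable_fun setT f. Proof. exact: continuous_measurable_fun. Qed.

Let int_e : (\int[lebesgue_measure]_(x in `[0%R, +oo[) (K * e x)%:E = (K * s)%:E)%E.
Proof.
refine (etrans (@ge0_FTC2y _ (fun x => K * e x) (fun x => - (K * s) * e x) 0 0 _ _ _ _) _).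
- by move=> x _; rewrite mulr_ge0// expR_ge0.
- move=> x _; rewrite (_ : (fun _ => _) = (- (K * s)) \*: e)//.
  apply: (is_derive_eq (is_deriveZ _ (de x))); rewrite /GRing.scale/=; field.
  by rewrite gt_eqF.
- by move=> x _; apply: cvgM; [exact: cvg_cst|exact: ce].
- by rewrite -[X in _ --> X](mulr0 (- (K * s))); apply: cvgM; [exact: cvg_cst|].
- by rewrite /e mul0r oppr0 expR0 mulr1 opprK add0r.
Qed.

(* [- x g(x)] is a primitive of [f - g]; adding [K e], a multiple of an exponential
   that dominates [g], makes the integrand nonnegative. *)
Let int_fg :
  (\int[lebesgue_measure]_(x in `[0%R, +oo[) (f x - g x + K * e x)%:E = (K * s)%:E)%E.
Proof.
refine (etrans (@ge0_FTC2y _ (fun x => f x - g x + K * e x)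
  (fun x => - (x * g x) + - (K * s) * e x) 0 0 _ _ _ _) _).
- by move=> x _; rewrite -addrA addr_ge0// addrC subr_ge0.
- move=> x _; rewrite (_ : (fun _ => _) = - (id * g) + (- (K * s)) \*: e)//.
  apply: (is_derive_eq (is_deriveD (is_deriveN (is_deriveM (is_derive_id x 1) (dg x)))
    (is_deriveZ _ (de x)))); rewrite /GRing.scale/= /f; field.
  by rewrite gt_eqF.
- move=> x _; apply: cvgD; first by apply: cvgB; [exact: cf|exact: cg].
  by apply: cvgM; [exact: cvg_cst|exact: ce].
- rewrite -[X in _ --> X](addr0 0); apply: cvgD.
    by rewrite -[X in _ --> X]oppr0; exact: cvgN.
  by rewrite -[X in _ --> X](mulr0 (- (K * s))); apply: cvgM; [exact: cvg_cst|].
- by rewrite /e !mul0r oppr0 expR0 !add0r mulr1 opprK.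
Qed.

(** This is integration by parts without signed integrals: [f + K e] is [(f - g + K e) + g], and the
    integrals of [K e] and of [f - g + K e] are the same finite number, which cancels. *)
Let int_f_eq_g : (\int[lebesgue_measure]_(x in `[0%R, +oo[) (f x)%:E =
  \int[lebesgue_measure]_(x in `[0%R, +oo[) (g x)%:E)%E.
Proof.
have g0 x : 0 <= g x by exact: expR_ge0.
have e0 x : 0 <= K * e x by rewrite mulr_ge0// expR_ge0.
have fge0 x : 0 <= f x - g x + K * e x.
  by rewrite -addrA addr_ge0// addrC subr_ge0.
have mKe : measurable_fun (`[0, +oo[ : set R) (EFin \o (fun x => K * e x)).
  by apply/measurable_EFinP/measurable_funTS; exact: measurable_funM.
have mf' : measurable_fun (`[0, +oo[ : set R) (EFin \o f).
  by apply/measurable_EFinP/measurable_funTS.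
have mg' : measurable_fun (`[0, +oo[ : set R) (EFin \o g).
  by apply/measurable_EFinP/measurable_funTS.
have mh' : measurable_fun (`[0, +oo[ : set R) (EFin \o (fun x => f x - g x + K * e x)).
  apply/measurable_EFinP/measurable_funTS; apply: measurable_funD.
    exact: measurable_funB.
  exact: measurable_funM.
have h : (\int[lebesgue_measure]_(x in `[0%R, +oo[) (f x)%:E + (K * s)%:E =
    \int[lebesgue_measure]_(x in `[0%R, +oo[) (g x)%:E + (K * s)%:E)%E.
  rewrite -{1}int_e -int_fg -!ge0_integralD//; try by move=> x _; rewrite lee_fin.
  by apply: eq_integral => x _; rewrite -!EFinD; congr EFin; ring.
by move/(congr1 (fun z => z - (K * s)%:E)%E) : h; rewrite !addeK.
Qed.

(** The integrand is [s^2] times the normalised [f]. By evenness and [int_f_eq_g], [f] has the same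
    integral over the line as [g], and the normalised [g] has total mass 1. *)
Lemma normal_second_moment :
  (\int[lebesgue_measure]_x (x ^+ 2 * normal_pdf 0 s x)%:E = (s ^+ 2)%:E)%E.
Proof.
have sn0 : s != 0 by rewrite gt_eqF.
have g0 x : 0 <= g x by exact: expR_ge0.
have gE x : normal_pdf 0 s x = normal_peak s * g x.
  by rewrite normal_pdfE// /normal_fun subr0 mulNr.
have p0 := normal_peak_ge0 s.
have I1 := integral_normal_pdf 0 s.
have fE x : x ^+ 2 * normal_pdf 0 s x = s ^+ 2 * (normal_peak s * f x).
  by rewrite gE /f; field.
under eq_integral do rewrite fE EFinM.
rewrite ge0_integralZl//; last 3 first.
- by apply/measurable_EFinP; exact: measurable_funM.
- by move=> x _; rewrite lee_fin mulr_ge0.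
- by rewrite lee_fin sqr_ge0.
rewrite -[RHS]mule1 -I1; congr (_ * _)%E.
under eq_integral do rewrite EFinM.
under [RHS]eq_integral do rewrite gE EFinM.
rewrite !ge0_integralZl//; last 4 first.
- by apply/measurable_EFinP.
- by move=> x _; rewrite lee_fin.
- by apply/measurable_EFinP.
- by move=> x _; rewrite lee_fin.
congr (_ * _)%E; rewrite !ge0_symfun_integralT//.
- by rewrite -set_itvcy int_f_eq_g.
- by move=> x; rewrite /g/= sqrrN.
- by move=> x; rewrite /f /g/= sqrrN.
Qed.

End normal_second_moment.

Lemma L2norm0 d (T : measurableType d) (R : realType) (mu : {measure set T -> \bar R}) :
  L2norm mu (fun=> 0) = 0%E.
Proof. exact: Lnorm0. Qed.

Section normal_integral.
Variable R : realType.

(** The abstract Radon-Nikodym derivative agrees almost everywhere with [normal_pdf], as both have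
    the same integral over every measurable set. *)
Lemma ge0_integral_normal_prob (s : R) (f : R -> \bar R) :
  (forall x, 0 <= f x)%E -> measurable_fun setT f ->
  (\int[normal_prob 0 s]_x f x =
   \int[lebesgue_measure]_x (f x * (normal_pdf 0 s x)%:E))%E.
Proof.
move=> f0 mf.
have dom := normal_prob_dominates 0 s.
have h := @Radon_Nikodym_SigmaFinite.change_of_variables _ _ _
  (normal_prob 0 s) lebesgue_measure dom f setT f0 measurableT mf.
refine (etrans (esym h) _) => {h}.
set g := Radon_Nikodym_SigmaFinite.f _ _.
have ig : lebesgue_measure.-integrable setT g.
  exact: Radon_Nikodym_SigmaFinite.f_integrable.
have mp : measurable_fun setT (fun x => (normal_pdf 0 s x)%:E).
  by apply/measurable_EFinP; exact: measurable_normal_pdf.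
apply: ae_eq_integral => //.
- by apply: emeasurable_funM => //; exact: measurable_int ig.
- exact: emeasurable_funM.
- apply: ae_eqe_mul2l; apply: integral_ae_eq => // E _ mE.
  by rewrite -Radon_Nikodym_SigmaFinite.f_integral.
Qed.

Lemma integral_sqr_centered_normal d (T : measurableType d)
    (P : probability T R) (Z : T -> R) (v : R) :
  measurable_fun setT Z -> 0 <= v ->
  (forall B, measurable B -> P [set w | B (Z w)] = centered_normal v B) ->
  (\int[P]_w (Z w ^+ 2)%:E = v%:E)%E.
Proof.
move=> mZ v0 ZE.
have msq : measurable_fun setT (fun x : R => (x ^+ 2)%:E).
  by apply/measurable_EFinP; exact: measurable_funX.
have -> : (\int[P]_w (Z w ^+ 2)%:E =
    \int[pushforward P (Z : T -> measurableTypeR R)]_x (x ^+ 2)%:E)%E.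
  rewrite ge0_integral_pushforward//=.
  by move=> x _; rewrite lee_fin sqr_ge0.
move: ZE; rewrite /centered_normal; case: eqVneq => [-> ZE|vn0 ZE].
  rewrite (@eq_measure_integral _ _ _ _ \d_(0 : measurableTypeR R)).
    by rewrite integral_dirac// diracT mul1e expr0n.
  by move=> A mA _; exact: ZE.
rewrite (@eq_measure_integral _ _ _ _ (normal_prob 0 (Num.sqrt v))); last first.
  by move=> A mA _; exact: ZE.
rewrite ge0_integral_normal_prob//; last by move=> x; rewrite lee_fin sqr_ge0.
under eq_integral do rewrite -EFinM.
rewrite normal_second_moment ?sqr_sqrtr// sqrtr_gt0 lt_neqAle v0 andbT.
by rewrite eq_sym.
Qed.

End normal_integral.

(** * The isometry of the Wiener integral *)

Section increments.
Context d (T : measurableType d) (R : realType).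

(* The variances of all the increments determine their covariances, by
   polarization: independence is not needed for the isometry. *)
Lemma L2dot_increments (mu : {measure set T -> \bar R}) (F : R -> T -> R) (t : R) :
  (forall s r : R, 0 <= s <= r -> r <= t -> L2 mu (fun x => F r x - F s x) /\
    L2dot mu (fun x => F r x - F s x) (fun x => F r x - F s x) = r - s) ->
  forall a b a' b' : R, 0 <= a <= b -> b <= t -> 0 <= a' <= b' -> b' <= t ->
  L2dot mu (fun x => F b x - F a x) (fun x => F b' x - F a' x) =
  minr b b' - minr b a' - minr a b' + minr a a'.
Proof.
move=> FE.
(* Only differences of [F] are known to be square integrable. Normalising at 0 keeps all increments
   and makes [G x] itself an increment. *)
pose G x w := F x w - F 0 w.
have LG x : 0 <= x <= t -> L2 mu (G x).
  by case/andP=> x0 xt; have [] := FE 0 x; rewrite ?lexx.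
have GG x : 0 <= x <= t -> L2dot mu (G x) (G x) = x.
  by case/andP=> x0 xt; have [] := FE 0 x; rewrite ?lexx ?subr0.
have E x y : (fun w => F y w - F x w) = (fun w => G y w - G x w).
  by apply/funext => w; rewrite /G; ring.
clearbody G.
(* Polarization: the squared norms of [G x], [G y] and [G y - G x] are [x], [y] and [y - x]. *)
have wl x y : 0 <= x <= y -> y <= t -> L2dot mu (G x) (G y) = x.
  move=> /andP[x0 xy] yt.
  have Lx : L2 mu (G x) by apply: LG; rewrite x0 (le_trans xy).
  have Ly : L2 mu (G y) by apply: LG; rewrite (le_trans x0).
  have := (FE x y); rewrite x0 xy => /(_ isT yt)[_].
  rewrite E.
  rewrite (@L2dotBl _ _ _ _ (G y) (G x))//; last exact: L2B.
  rewrite !L2dotBr// !GG ?(L2dotC mu (G y)); last 2 first.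
  - by rewrite x0 (le_trans xy).
  - by rewrite (le_trans x0).
  lra.
have GE x y : 0 <= x <= t -> 0 <= y <= t -> L2dot mu (G x) (G y) = minr x y.
  move=> /andP[x0 xt] /andP[y0 yt]; have [xy|yx] := leP x y.
    by rewrite wl// x0.
  by rewrite L2dotC wl// y0 ltW.
move=> a b a' b' /andP[a0 ab] bt /andP[a'0 a'b'] b't.
have Ia : 0 <= a <= t by rewrite a0 (le_trans ab).
have Ib : 0 <= b <= t by rewrite (le_trans a0).
have Ia' : 0 <= a' <= t by rewrite a'0 (le_trans a'b').
have Ib' : 0 <= b' <= t by rewrite (le_trans a'0).
rewrite !E (@L2dotBl _ _ _ _ (G b) (G a)); try by [apply: LG|apply: L2B; exact: LG].
by rewrite !L2dotBr; try exact: LG; rewrite !GE//; lra.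
Qed.

End increments.

Section wiener_isometry.
Context d (T : measurableType d) (R : realType).
Variable P : probability T R.
Variable B : R -> T -> R.
Hypothesis mB : forall s, measurable_fun setT (B s).
Hypothesis varB : forall s r : R, 0 <= s <= r ->
  (\int[P]_w ((B r w - B s w) ^+ 2)%:E = (r - s)%:E)%E.
Variable t : R.

Lemma L2_increment (s r : R) : 0 <= s <= r -> L2 P (fun w => B r w - B s w).
Proof.
move=> sr; apply/L2P; split; first exact: measurable_funB.
by rewrite varB// ltry.
Qed.

Lemma integral_leb_upto_indic (s r : R) : 0 <= s <= r -> r <= t ->
  (\int[leb_upto t]_x ((\1_`[s, r[ x : R) ^+ 2)%:E = (r - s)%:E)%E.
Proof.
move=> /andP[s0 sr] rt.
under eq_integral do rewrite expr2 indicE -natrM mulnb andbb -indicE.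
rewrite integral_indic//= setIT /leb_upto/= /mrestr.
rewrite (_ : `[s, r[%classic `&` `[0, t[%classic = `[s, r[%classic); last first.
  apply/setIidl => x /=; rewrite !in_itv/= => /andP[sx xr].
  by rewrite (le_trans s0)// (lt_le_trans xr).
rewrite lebesgue_measure_itv/= lte_fin; case: ltP => // rs.
by rewrite (_ : s = r) ?subrr//; apply/eqP; rewrite eq_le sr.
Qed.

Lemma L2_indic (s r : R) : 0 <= s <= r -> r <= t -> L2 (leb_upto t) (\1_`[s, r[ : R -> R).
Proof.
by move=> sr rt; apply/L2P; split => //; rewrite integral_leb_upto_indic// ltry.
Qed.

(** This exhibits an indicator as an increment of [x |-> 1_[0, x[], the form to which
    [L2dot_increments] applies. *)
Lemma indic_itvB (s r : R) : 0 <= s <= r ->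
  (\1_`[s, r[ : R -> R) = (fun x => \1_`[0, r[ x - \1_`[0, s[ x).
Proof.
move=> /andP[s0 sr]; apply/funext => x; rewrite !indicE !mem_setE !in_itv/=.
have [sx|xs] := leP s x; first by rewrite (le_trans s0 sx)/= subr0.
by rewrite (lt_le_trans xs sr) !andbT subrr.
Qed.

(** Both inner products are instances of [L2dot_increments], hence the same expression in minima of
    endpoints, whatever the overlap of the two intervals. *)
Lemma L2dot_increment_indic (s r s' r' : R) : 0 <= s <= r -> r <= t ->
  0 <= s' <= r' -> r' <= t ->
  L2dot P (fun w => B r w - B s w) (fun w => B r' w - B s' w) =
  L2dot (leb_upto t) (\1_`[s, r[) (\1_`[s', r'[).
Proof.
move=> sr rt sr' rt'.
rewrite (@L2dot_increments _ _ _ P B t)//; last first.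
  move=> a b ab bt; split; first exact: L2_increment.
  by apply: EFin_inj; rewrite L2dot_self ?varB//; exact: L2_increment.
rewrite (indic_itvB sr) (indic_itvB sr').
rewrite (@L2dot_increments _ _ _ (leb_upto t) (fun x : R => \1_`[0, x[ : R -> R) t)//.
move=> a b ab bt; rewrite -indic_itvB//; split; first exact: L2_indic.
apply: EFin_inj; rewrite L2dot_self ?integral_leb_upto_indic//.
exact: L2_indic.
Qed.

Lemma le_mono_upto n (s : nat -> R) :
  (forall i, (i < n)%N -> s i <= s i.+1) ->
  forall i j, (i <= j)%N -> (j <= n)%N -> s i <= s j.
Proof.
move=> ndx i j ij; rewrite -(subnKC ij); elim: (j - i)%N => [|k IH] kn.
  by rewrite addn0.
rewrite addnS in kn *; apply: le_trans (ndx _ kn); apply: IH.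
exact: ltnW.
Qed.

Section step.
Variables (n : nat) (s a : nat -> R).
Hypotheses (s0 : 0 <= s 0%N) (st : s n <= t).
Hypothesis nds : forall i, (i < n)%N -> s i <= s i.+1.

Let s_bnd i : (i < n)%N -> 0 <= s i <= s i.+1 /\ s i.+1 <= t.
Proof.
move=> ni; rewrite nds// (le_trans s0) ?(le_mono_upto nds)//; last exact: ltnW.
by rewrite (le_trans (le_mono_upto nds ni (leqnn n))).
Qed.

Lemma L2_step_integral : L2 P (step_integral B n s a).
Proof.
apply: (L2_sum (f := fun i w => B (s i.+1) w - B (s i) w)) => i ni.
by apply: L2_increment; have [] := s_bnd ni.
Qed.

Lemma L2_step_fun : L2 (leb_upto t) (step_fun n s a).
Proof.
apply: (@L2_sum _ (measurableTypeR R) _ _ n (fun i => \1_`[s i, s i.+1[)) => i ni.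
by have [? ?] := s_bnd ni; exact: L2_indic.
Qed.

Lemma L2dot_step_integral_increment s' r' : 0 <= s' <= r' -> r' <= t ->
  L2dot P (step_integral B n s a) (fun w => B r' w - B s' w) =
  L2dot (leb_upto t) (step_fun n s a) (\1_`[s', r'[).
Proof.
move=> sr' r't.
rewrite /step_integral (L2dot_suml (f := fun i w => B (s i.+1) w - B (s i) w)); last 2 first.
- by move=> i ni; apply: L2_increment; have [] := s_bnd ni.
- exact: L2_increment.
rewrite /step_fun (@L2dot_suml _ (measurableTypeR R) _ _ n (fun i => \1_`[s i, s i.+1[)); last 2 first.
- by move=> i ni; have [? ?] := s_bnd ni; exact: L2_indic.
- exact: L2_indic.
apply: eq_bigr => i _; congr (_ * _); have [? ?] := s_bnd (ltn_ord i).
exact: L2dot_increment_indic.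
Qed.

End step.

(** No common refinement of the two partitions is taken: bilinearity reduces the claim to pairs of
    single increments. *)
Lemma L2dot_step_integral n (s a : nat -> R) m (s' a' : nat -> R) :
  0 <= s 0%N -> s n <= t -> (forall i, (i < n)%N -> s i <= s i.+1) ->
  0 <= s' 0%N -> s' m <= t -> (forall i, (i < m)%N -> s' i <= s' i.+1) ->
  L2dot P (step_integral B n s a) (step_integral B m s' a') =
  L2dot (leb_upto t) (step_fun n s a) (step_fun m s' a').
Proof.
move=> s0 st nds s'0 s't nds'.
have s_bnd i : (i < m)%N -> 0 <= s' i <= s' i.+1 /\ s' i.+1 <= t.
  move=> ni; rewrite nds'// (le_trans s'0) ?(le_mono_upto nds')//; last exact: ltnW.
  by rewrite (le_trans (le_mono_upto nds' ni (leqnn m))).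
rewrite L2dotC [RHS]L2dotC.
rewrite [X in L2dot P X]/step_integral (L2dot_suml (f := fun i w => B (s' i.+1) w - B (s' i) w)); last 2 first.
- by move=> i ni; apply: L2_increment; have [] := s_bnd _ ni.
- exact: L2_step_integral.
rewrite [X in L2dot (leb_upto t) X]/step_fun
  (@L2dot_suml _ (measurableTypeR R) _ _ m (fun i => \1_`[s' i, s' i.+1[)); last 2 first.
- by move=> i ni; have [? ?] := s_bnd _ ni; exact: L2_indic.
- exact: L2_step_fun.
apply: eq_bigr => i _; congr (_ * _); have [? ?] := s_bnd _ (ltn_ord i).
rewrite L2dotC [RHS]L2dotC; exact: L2dot_step_integral_increment.
Qed.

Lemma L2norm_step_integralB n (s a : nat -> R) m (s' a' : nat -> R) :
  0 <= s 0%N -> s n <= t -> (forall i, (i < n)%N -> s i <= s i.+1) ->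
  0 <= s' 0%N -> s' m <= t -> (forall i, (i < m)%N -> s' i <= s' i.+1) ->
  L2norm P (fun w => step_integral B n s a w - step_integral B m s' a' w) =
  L2norm (leb_upto t) (fun x => step_fun n s a x - step_fun m s' a' x).
Proof.
move=> s0 st nds s'0 s't nds'.
have L1 := L2_step_integral a s0 st nds.
have L1' := L2_step_integral a' s'0 s't nds'.
have L3 := L2_step_fun a s0 st nds.
have L3' := L2_step_fun a' s'0 s't nds'.
rewrite !L2norm_sqrt; try exact: L2B.
rewrite !L2dotBl//; try exact: L2B.
by rewrite !L2dotBr// !L2dot_step_integral.
Qed.

(** The triangle inequality is used on both sides of the step-function isometry: [I - J] is compared
    with [S - S'], whose norm is that of [u - u'], and this is compared with [f - g]. The four
    approximation errors tend to 0. *)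
Lemma wiener_integralB_le (f g : R -> R) (I J : T -> R) :
  is_wiener_integral P B t f I -> is_wiener_integral P B t g J ->
  (L2norm P (fun w => I w - J w)%R <= L2norm (leb_upto t) (fun x => f x - g x)%R)%E.
Proof.
move=> [Lf LI [n [s [a [s0 nds cvf cvI]]]]] [Lg LJ [m [s' [a' [s'0 nds' cvg cvJ]]]]].
have D := L2norm_fin_num (L2B Lf Lg).
have add0 (u v : nat -> \bar R) (l : \bar R) : l \is a fin_num ->
    u @ \oo --> 0%E -> v @ \oo --> l -> (fun j => u j + v j)%E @ \oo --> l.
  by move=> fl u0 vl; rewrite -(add0e l); apply: cvgeD => //; exact: fin_num_adde_defl.
have cvL : (fun=> L2norm (leb_upto t) (fun x => f x - g x)) @ \oo -->
    L2norm (leb_upto t) (fun x => f x - g x) by exact: cvg_cst.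
have cv := add0 _ _ _ D cvI (add0 _ _ _ D cvJ (add0 _ _ _ D cvf (add0 _ _ _ D cvg cvL))).
rewrite -(cvg_lim _ cv)//; apply: lime_ge.
  by apply/cvg_ex; exists (L2norm (leb_upto t) (fun x => f x - g x)).
near=> j; have [s0j stj] := s0 j; have [s'0j s'tj] := s'0 j.
have L1 := L2_step_integral (a j) s0j stj (nds j).
have L1' := L2_step_integral (a' j) s'0j s'tj (nds' j).
have L3 := L2_step_fun (a j) s0j stj (nds j).
have L3' := L2_step_fun (a' j) s'0j s'tj (nds' j).
set S := step_integral _ _ _ (a j) in L1 *; set S' := step_integral _ _ _ (a' j) in L1' *.
set u := step_fun _ _ (a j) in L3 *; set u' := step_fun _ _ (a' j) in L3' *.
have SE : L2norm P (fun w => S w - S' w) = L2norm (leb_upto t) (fun x => u x - u' x).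
  exact: (L2norm_step_integralB _ _ s0j stj (nds j) s'0j s'tj (nds' j)).
have m1 := L2_measurable LI; have m2 := L2_measurable LJ.
have m3 := L2_measurable L1; have m4 := L2_measurable L1'.
have m5 := L2_measurable Lf; have m6 := L2_measurable Lg.
have m7 := L2_measurable L3; have m8 := L2_measurable L3'.
have -> : (fun w => I w - J w) = (fun w => (I w - S w) + ((S' w - J w) + (S w - S' w))).
  by apply/funext => w; ring.
apply: le_trans (L2normD _ _ _) _; [exact: measurable_funB| |].
  by apply: measurable_funD; exact: measurable_funB.
rewrite L2norm_sub leeD2l//.
apply: le_trans (L2normD _ _ _) _; [exact: measurable_funB|exact: measurable_funB|].
rewrite leeD2l// SE.
have -> : (fun x => u x - u' x) = (fun x => (u x - f x) + ((g x - u' x) + (f x - g x))).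
  by apply/funext => w; ring.
apply: le_trans (L2normD _ _ _) _; [exact: measurable_funB| |].
  by apply: measurable_funD; exact: measurable_funB.
rewrite leeD2l//.
apply: le_trans (L2normD _ _ _) _; [exact: measurable_funB|exact: measurable_funB|].
by rewrite L2norm_sub.
Unshelve. all: by end_near. Qed.

Lemma is_wiener_integral0 : 0 <= t ->
  is_wiener_integral P B t (fun=> 0) (fun=> 0).
Proof.
move=> t0; split; [exact: L20|exact: L20|].
exists (fun=> 0%N), (fun _ _ => 0), (fun _ _ => 0); split => //.
- rewrite (_ : (fun _ => _) = fun=> 0%E); first exact: cvg_cst.
  apply/funext => j; rewrite -[RHS](L2norm0 (leb_upto t)); congr L2norm.
  by apply/funext => x; rewrite /step_fun big_ord0 subr0.
- rewrite (_ : (fun _ => _) = fun=> 0%E); first exact: cvg_cst.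
  apply/funext => j; rewrite -[RHS](L2norm0 P); congr L2norm.
  by apply/funext => x; rewrite /step_integral big_ord0 subr0.
Qed.

Lemma wiener_integral_le (f : R -> R) (I : T -> R) : 0 <= t ->
  is_wiener_integral P B t f I -> (L2norm P I <= L2norm (leb_upto t) f)%E.
Proof.
move=> t0 fI; have := wiener_integralB_le fI (is_wiener_integral0 t0).
under eq_fun do rewrite subr0.
by under [X in (_ <= L2norm _ X)%E -> _]eq_fun do rewrite subr0.
Qed.

End wiener_isometry.

(** * Integrals of powers and exponentials *)

Section integration.
Variable R : realType.
Local Notation leb := (@lebesgue_measure R).
Implicit Types (f : R -> \bar R) (a c t : R).

Lemma ge0_integral_mrestr d (T : measurableType d) (mu : {measure set T -> \bar R})
    (D : set T) (mD : measurable D) (f : T -> \bar R) :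
  measurable_fun setT f -> (forall x : T, 0 <= f x)%E ->
  (\int[mrestr mu mD]_x f x = \int[mu]_(x in D) f x)%E.
Proof.
move=> mf f0; rewrite -(setUv D) ge0_integral_setU//.
- rewrite [X in (_ + X)%E](_ : _ = 0%E) ?adde0; last first.
    apply: null_set_integral; first exact: measurableC.
      exact: measurable_funTS.
    by apply: etrans (measure0 mu); congr (mu _); exact: setICl.
  by apply: eq_measure_integral => A mA AD; congr (mu _); exact: setIidl.
- exact: measurableC.
- by rewrite setUv.
- exact/disj_setPCl.
Qed.

Let refl t : measurableTypeR R -> measurableTypeR R := fun x => t - x.
Let scal c : measurableTypeR R -> measurableTypeR R := fun x => c * x.

Let mrefl t : measurable_fun setT (refl t).
Proof. exact: measurable_funB. Qed.

Let mscal c : measurable_fun setT (scal c).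
Proof. exact: measurable_funM. Qed.

(** By uniqueness of Lebesgue measure it suffices to test []a, b]], whose reflection [[t - b, t -
    a[] has the same length. *)
Let lebesgue_measure_reflect t (A : set R) : measurable A ->
  pushforward leb (refl t) A = leb A.
Proof.
move=> mA; apply/esym; apply: (@lebesgue_measure_unique _ (pushforward leb (refl t))) => //= _ [[a b]] _ <-.
rewrite /pushforward/= (_ : _ @^-1` _ = `[t - b, t - a[%classic); last first.
  by apply/seteqP; split => x /=; rewrite /refl !in_itv/= => /andP[? ?]; apply/andP; split; lra.
rewrite !lebesgue_measure_itv/= !lte_fin ltrD2l ltrN2.
by case: ltP => // _; rewrite -!EFinD; congr EFin; ring.
Qed.

Lemma ge0_integral_reflect t (D : set R) f : measurable D ->
  measurable_fun D f -> (forall x, D x -> 0 <= f x)%E ->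
  (\int[leb]_(x in (fun x => t - x)%R @^-1` D) f (t - x)%R = \int[leb]_(x in D) f x)%E.
Proof.
move=> mD mf f0.
transitivity (\int[pushforward leb (refl t)]_(x in D) f x)%E.
  by rewrite ge0_integral_pushforward//= => x; rewrite inE => /f0.
by apply: eq_measure_integral => A mA _; exact: lebesgue_measure_reflect.
Qed.

Let lebesgue_measure_scale c (A : set R) : 0 < c -> measurable A ->
  (leb A = c%:E * pushforward leb (scal c) A)%E.
Proof.
move=> c0 mA.
apply: (@lebesgue_measure_unique _ (mscale (NngNum (ltW c0)) (pushforward leb (scal c)))) => //= _ [[a b]] _ <-.
rewrite /mscale/= /pushforward/= (_ : _ @^-1` _ = `]a / c, b / c]%classic); last first.
  apply/seteqP; split => x /=; rewrite /scal !in_itv/=.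
    by rewrite ltr_pdivrMr// ler_pdivlMr// !(mulrC x).
  by rewrite ltr_pdivrMr// ler_pdivlMr// !(mulrC x).
rewrite !lebesgue_measure_itv/= !lte_fin ltr_pM2r ?invr_gt0//.
case: ltP => // _; last by rewrite mule0.
by rewrite -!EFinD -EFinM; congr EFin; field; rewrite gt_eqF.
Qed.

Lemma ge0_integral_scale c (D : set R) f : 0 < c -> measurable D ->
  measurable_fun D f -> (forall x, D x -> 0 <= f x)%E ->
  (\int[leb]_(x in (fun x => c * x)%R @^-1` D) f (c * x)%R =
   c^-1%:E * \int[leb]_(x in D) f x)%E.
Proof.
move=> c0 mD mf f0.
transitivity (\int[pushforward leb (scal c)]_(x in D) f x)%E.
  by rewrite ge0_integral_pushforward//= => x; rewrite inE => /f0.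
have cV0 : 0 <= c^-1 by rewrite invr_ge0 ltW.
rewrite -(ge0_integral_mscale leb mD (NngNum cV0))//=.
apply: eq_measure_integral => A mA _ /=; rewrite /mscale/= (lebesgue_measure_scale c0 mA).
by rewrite muleA -EFinM mulVf ?mul1e ?gt_eqF.
Qed.

Lemma integral_expR (c : R) : 0 < c ->
  (\int[leb]_(x in `[0%R, +oo[) (expR (- (c * x)))%:E = c^-1%:E)%E.
Proof.
move=> c0.
have de (x : R) : is_derive x 1 (fun x : R => expR (- (c * x))) (expR (- (c * x)) * - c).
  apply: (is_derive1_comp (f := expR) (g := fun x => - (c * x))).
  apply: is_deriveN.
  rewrite (_ : ( *%R c) = c \*: (id : R -> R)); last exact/funext.
  by apply: is_derive_eq; rewrite /= /GRing.scale/= mulr1.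
refine (etrans (@ge0_FTC2y _ (fun x => expR (- (c * x)))
  (fun x => - c^-1 * expR (- (c * x))) 0 0 _ _ _ _) _).
- by move=> x _; exact: expR_ge0.
- move=> x _; apply: (is_derive_eq (is_deriveZ _ (de x))).
  by rewrite /GRing.scale/=; field; rewrite gt_eqF.
- move=> x _; apply/differentiable_continuous/derivable1_diffP.
  by have [] := de x.
- rewrite -[X in _ --> X](mulr0 (- c^-1)); apply: cvgM; first exact: cvg_cst.
  apply: (@cvg_comp _ _ _ (fun x => c * x) (fun x => expR (- x)) _ (pinfty_nbhs R)).
    exact: gt0_cvgMry.
  exact: cvgr_expR.
- by rewrite mulr0 oppr0 expR0 mulr1 sub0r opprK.
Qed.

Lemma integral_powR_itv a c d : 0 < c -> c < d -> a + 1 != 0 ->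
  (\int[leb]_(x in `[c, d]) (x `^ a)%:E =
   ((d `^ (a + 1) - c `^ (a + 1)) / (a + 1))%:E)%E.
Proof.
move=> c0 cd a1.
refine (etrans (@FTC2 _ (fun x => x `^ a) (fun x => (a + 1)^-1 * x `^ (a + 1)) c d cd _ _) _).
- move=> x /andP[cx _]; have x0 : 0 < x by exact: lt_le_trans cx.
  apply: (is_derive_eq (is_deriveZ _ (is_derive1_powR _ x0))).
  by rewrite /GRing.scale/= mulrA mulVf// mul1r addrK.
- move=> x /andP[cx _]; have x0 : 0 < x by exact: lt_le_trans cx.
  apply/differentiable_continuous/derivable1_diffP.
  by have [] := is_derive1_powR a x0.
- by congr EFin; field.
Qed.

Lemma integral_inv_itv c d : 0 < c -> c < d ->
  (\int[leb]_(x in `[c, d]) (x^-1)%:E = (ln (d / c))%:E)%E.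
Proof.
move=> c0 cd.
refine (etrans (@FTC2 _ (fun x => x^-1) (fun x => ln x) c d cd _ _) _).
- by move=> x /andP[cx _]; apply: is_derive1_ln; exact: lt_le_trans cx.
- move=> x /andP[cx _]; apply: inv_continuous.
  by rewrite gt_eqF// (lt_le_trans c0).
- by rewrite ln_div// posrE (lt_trans c0).
Qed.

Lemma measurable_powR_EFin a (D : set R) : measurable_fun D (fun x : R => (x `^ a)%:E).
Proof. by apply/measurable_EFinP/measurable_funTS; exact: measurable_powR. Qed.

(** The exponent may be negative, so []0, c]] is exhausted by compact intervals away from 0, and
    monotone convergence passes to the limit. *)
Lemma integral_powR_le a c : 0 < a + 1 -> 0 <= c ->
  (\int[leb]_(x in `]0%R, c]) (x `^ a)%:E <= (c `^ (a + 1) / (a + 1))%:E)%E.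
Proof.
move=> a1; rewrite le_eqVlt => /predU1P[<-|c0].
  rewrite set_itvoc0 integral_set0 lee_fin divr_ge0 ?powR_ge0// ltW//.
(* The divisor starts at 2 so that every interval is nondegenerate, as [integral_powR_itv]
   demands. *)
pose F n : set R := `[c / n.+2%:R, c]%classic.
have UF : `]0%R, c]%classic = \bigcup_n F n.
  apply/seteqP; split => [x /=|x [n _]]/=; rewrite !in_itv/=.
    move=> /andP[x0 xc]; have [n] := ltr_add_invr (divr_gt0 x0 c0).
    rewrite add0r => nP; exists n => //=; rewrite /F/= in_itv/= xc andbT.
    rewrite ler_pdivrMr//; move: nP; rewrite ltr_pdivlMr// mulrC ltr_pdivrMr// => nP.
    apply: ltW; apply: lt_le_trans nP _; rewrite ler_pM2l// ler_nat//.
  rewrite /F/= in_itv/= => /andP[+ ->]; rewrite andbT; apply: lt_le_trans.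
  by rewrite divr_gt0.
have h := @ge0_nondecreasing_set_cvg_integral _ (measurableTypeR R) R F (fun x => (x `^ a)%:E) leb.
have {}h : (\int[leb]_(x in F i) (x `^ a)%:E)%E @[i --> \oo] -->
    (\int[leb]_(x in \bigcup_i F i) (x `^ a)%:E)%E.
  apply: h => //.
  - move=> n m nm; apply/subsetPset => x; rewrite /F/= !in_itv/= => /andP[cx ->].
    rewrite andbT; apply: le_trans cx; rewrite ler_pM2l// lef_pV2 ?posrE//.
    by rewrite ler_nat !ltnS.
  - by move=> i; exact: measurable_itv.
  - by move=> i; exact: measurable_powR_EFin.
  - by move=> i x _; rewrite lee_fin powR_ge0.
rewrite UF -(cvg_lim _ h)//.
apply: lime_le; first by apply/cvg_ex; eexists; exact: h.
near=> n; rewrite integral_powR_itv//; last 3 first.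
  + by rewrite divr_gt0.
  + by rewrite ltr_pdivrMr// ltr_pMr// ltr1n.
  + by rewrite gt_eqF.
  by rewrite lee_fin ler_pM2r ?invr_gt0// gerBl powR_ge0.
Unshelve. all: by end_near. Qed.

Lemma integral_leb_upto_reflect t f : measurable_fun setT f -> (forall x, 0 <= f x)%E ->
  (\int[leb_upto t]_s f (t - s)%R = \int[leb]_(x in `]0%R, t]) f x)%E.
Proof.
move=> mf f0; rewrite /leb_upto ge0_integral_mrestr//; last first.
  by apply: (measurableT_comp mf); exact: measurable_funB.
rewrite -(@ge0_integral_reflect t)//; last exact: measurable_funTS.
congr (integral _ _ _); apply/seteqP.
by split => x /=; rewrite !in_itv/= => /andP[? ?]; apply/andP; split; lra.
Qed.

(** One term of the exponential series gives [(x / 2)^(n+1) <= (n+1)! e^(x/2)]; half of the decay of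
    [e^(-x)] absorbs the power. *)
Lemma exprS_expR_le n (x : R) : 0 <= x ->
  x ^+ n.+1 * expR (- x) <= 2 ^+ n.+1 * n.+1`!%:R * expR (- (2^-1 * x)).
Proof.
move=> x0; have x20 : 0 <= x / 2 by rewrite divr_ge0.
have f0 : 0 < n.+1`!%:R :> R by rewrite ltr0n fact_gt0.
have := expR_ge1Dxn n x20; rewrite -(ler_pM2r f0) mulrDl mul1r divfK ?gt_eqF// => h.
have {h}h : (x / 2) ^+ n.+1 <= n.+1`!%:R * expR (x / 2).
  by rewrite [leRHS]mulrC; apply: le_trans h; rewrite lerDr ltW.
have -> : expR (- (2^-1 * x)) = expR (x / 2) * expR (- x).
  by rewrite -expRD; congr expR; field.
rewrite mulrA ler_pM2r ?expR_gt0// -[X in X ^+ _ <= _](divfK (_ : 2 != 0 :> R))//.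
by rewrite exprMn mulrC -mulrA ler_pM2l ?exprn_gt0.
Qed.

(** Below 1 the power alone is integrable; above 1 it is dominated by an integer power, which
    [exprS_expR_le] absorbs. Finiteness matters because [Gamma] is a real-valued integral, which
    takes the value 0 on divergence. *)
Lemma Gamma_integral_lty (z : R) : 0 < z ->
  (\int[leb]_(s in `]0%R, +oo[) (s `^ (z - 1) * expR (- s))%:E < +oo)%E.
Proof.
move=> z0; pose F (s : R) : \bar R := (s `^ (z - 1) * expR (- s))%:E.
have mF D : measurable_fun D F.
  apply/measurable_EFinP/measurable_funTS; apply: measurable_funM.
    exact: measurable_powR.
  by apply: measurableT_comp => //; exact: measurableT_comp.
have F0 (s : R) : (0 <= F s)%E by rewrite lee_fin mulr_ge0 ?powR_ge0 ?expR_ge0.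
have -> : `]0%R, +oo[%classic = `]0%R, 1%R] `|` `]1%R, +oo[ :> set R.
  apply/seteqP; split => x /=; rewrite !in_itv/= !andbT.
    by move=> ->; have [_|_] := leP x 1; [left|right].
  by case=> [/andP[]//|]; exact: lt_trans.
rewrite ge0_integral_setU//; last first.
  apply/disj_set2P; apply/seteqP; split => x //=; rewrite !in_itv/= andbT.
  by case=> /andP[_ x1]; rewrite ltNge x1.
- by move=> x _; exact: F0.
- exact: mF.
apply: lte_add_pinfty.
  apply: (@le_lt_trans _ _ (\int[leb]_(s in `]0%R, 1%R]) (s `^ (z - 1))%:E)%E).
    apply: ge0_le_integral => //; [by move=> x _; exact: F0|exact: mF|exact: measurable_powR_EFin|].
    move=> x /=; rewrite in_itv/= => /andP[x0 _].
    by rewrite lee_fin ler_piMr ?powR_ge0// expR_le1 oppr_le0 ltW.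
  apply: (le_lt_trans (integral_powR_le _ _)); rewrite ?subrK// ltry//.
have [n zn] : exists n, z - 1 <= n.+1%:R.
  exists (Num.bound `|z - 1|); apply: le_trans (ler_norm _) _.
  by apply: ltW; apply: lt_trans (archi_boundP _) _ => //; rewrite ltr_nat.
apply: (@le_lt_trans _ _ (\int[leb]_(s in `[0%R, +oo[)
    ((2 ^+ n.+1 * n.+1`!%:R)%:E * (expR (- (2^-1 * s)))%:E))%E).
  have mG : measurable_fun setT (fun s : R => ((2 ^+ n.+1 * n.+1`!%:R)%:E * (expR (- (2^-1 * s)))%:E)%E).
    apply/measurable_EFinP; apply: measurable_funM => //.
    by apply: measurableT_comp => //; apply: measurableT_comp => //; exact: measurable_funM.
  apply: (@le_trans _ _ (\int[leb]_(s in `]1%R, +oo[)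
    ((2 ^+ n.+1 * n.+1`!%:R)%:E * (expR (- (2^-1 * s)))%:E))%E).
    apply: ge0_le_integral => //; [by move=> x _; exact: F0|exact: mF|exact: measurable_funTS|].
    move=> x /=; rewrite in_itv/= andbT => x1; have x0 := lt_trans ltr01 x1.
    rewrite lee_fin; apply: le_trans (exprS_expR_le n (ltW x0)).
    by rewrite ler_pM2r ?expR_gt0// -powR_mulrn ?(ltW x0)// ler_powR// ltW.
  apply: ge0_subset_integral => //; first exact: measurable_funTS.
  by move=> x /=; rewrite !in_itv/= !andbT => x1; exact: ltW (lt_trans ltr01 x1).
rewrite ge0_integralZl//; last first.
  apply/measurable_EFinP/measurable_funTS.
  by apply: measurableT_comp => //; apply: measurableT_comp => //; exact: measurable_funM.
by rewrite integral_expR// -EFinM ltry.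
Qed.

Lemma integral_Gamma (z : R) : 0 < z ->
  (\int[leb]_(s in `]0%R, +oo[) (s `^ (z - 1) * expR (- s))%:E = (Gamma z)%:E)%E.
Proof.
move=> z0; rewrite /Gamma /Rintegral fineK// ge0_fin_numE ?Gamma_integral_lty//.
by apply: integral_ge0 => x _; rewrite lee_fin mulr_ge0 ?powR_ge0 ?expR_ge0.
Qed.

Lemma Gamma_ge0 (z : R) : 0 <= Gamma z.
Proof. by apply: Rintegral_ge0 => x _; rewrite mulr_ge0 ?powR_ge0 ?expR_ge0. Qed.

(** After [x = t - s] and extension to the half-line, the substitution [y = 2 mu x] gives [Gamma (2
    gamma - 1) * (2 mu)^(1 - 2 gamma)]; the factor [2^(1 - 2 gamma) <= 1] is then dropped. *)
Lemma integral_kernel_Gamma_le (gamma t mu : R) : 2^-1 < gamma -> 0 < mu ->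
  (\int[leb_upto t]_s ((expR (- (mu * (t - s))) * power_kernel gamma t s) ^+ 2)%:E
   <= (Gamma (2 * gamma - 1) * mu `^ (- (2 * gamma - 1)))%:E)%E.
Proof.
move=> g12 mu0; pose z := 2 * gamma - 1.
have z0 : 0 < z by rewrite /z; lra.
have c0 : 0 < 2 * mu by rewrite mulr_gt0.
pose H (x : R) : \bar R := (x `^ (z - 1) * expR (- x))%:E.
have mH : measurable_fun setT H.
  apply/measurable_EFinP; apply: measurable_funM; first exact: measurable_powR.
  by apply: measurableT_comp => //; exact: measurableT_comp.
have H0 x : (0 <= H x)%E by rewrite lee_fin mulr_ge0 ?powR_ge0 ?expR_ge0.
pose G (x : R) : \bar R := ((expR (- (mu * x)) * x `^ (gamma - 1)) ^+ 2)%:E.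
have mG : measurable_fun setT G.
  apply/measurable_EFinP/measurable_funX; apply: measurable_funM.
    by apply: measurableT_comp => //; apply: measurableT_comp => //; exact: measurable_funM.
  exact: measurable_powR.
have G0 x : (0 <= G x)%E by rewrite lee_fin sqr_ge0.
rewrite (integral_leb_upto_reflect t mG G0).
apply: (@le_trans _ _ (\int[leb]_(x in `]0%R, +oo[) G x)%E).
  apply: ge0_subset_integral => //; first exact: measurable_funTS.
  by move=> x /=; rewrite !in_itv/= andbT => /andP[].
have -> : (\int[leb]_(x in `]0%R, +oo[) G x =
    \int[leb]_(x in (fun x => (2 * mu) * x)%R @^-1` `]0%R, +oo[)
      (((2 * mu) `^ (- (z - 1)))%:E * H ((2 * mu) * x)%R))%E.
  rewrite (_ : _ @^-1` _ = `]0%R, +oo[%classic); last first.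
    by apply/seteqP; split => x /=; rewrite !in_itv/= !andbT pmulr_rgt0.
  apply: eq_integral => x; rewrite inE/= in_itv/= andbT => x0.
  rewrite -EFinM; congr EFin.
  rewrite (powRM _ (ltW c0) (ltW x0)) !mulrA -powRD; last first.
    by rewrite (gt_eqF c0) implybT.
  rewrite addNr powRr0 mul1r exprMn -[(x `^ _) ^+ 2]powR_mulrn ?powR_ge0// -powRrM mulrC.
  congr (_ `^ _ * _); first by rewrite /z; ring.
  by rewrite expr2 -expRD; congr expR; ring.
have -> := @ge0_integral_scale (2 * mu) `]0%R, +oo[%classic
  (fun y => ((2 * mu) `^ (- (z - 1)))%:E * H y)%E c0.
- rewrite ge0_integralZl//; last 2 first.
  + exact: measurable_funTS.
  + by rewrite lee_fin powR_ge0.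
  rewrite integral_Gamma// -!EFinM lee_fin mulrA [leLHS]mulrC ler_wpM2l ?Gamma_ge0//.
  rewrite -(powR_inv1 (ltW c0)) -powRD; last by rewrite (gt_eqF c0) implybT.
  rewrite (_ : -1 + - (z - 1) = - z); last by ring.
  rewrite !powRN lef_pV2 ?posrE ?powR_gt0//.
  by apply: ge0_ler_powR; rewrite ?nnegrE ?ltW//; lra.
- by [].
- by apply: measurable_funTS; exact: emeasurable_funM.
- by move=> x _; rewrite mule_ge0// lee_fin powR_ge0.
Qed.

Lemma integral_expR_upto_le (c t : R) : 0 < c ->
  (\int[leb_upto t]_s (expR (- (c * (t - s))))%:E <= c^-1%:E)%E.
Proof.
move=> c0; pose G (x : R) : \bar R := (expR (- (c * x)))%:E.
have mG : measurable_fun setT G.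
  apply/measurable_EFinP; apply: measurableT_comp => //.
  by apply: measurableT_comp => //; exact: measurable_funM.
have G0 x : (0 <= G x)%E by rewrite lee_fin expR_ge0.
rewrite (integral_leb_upto_reflect t mG G0) -integral_expR//.
apply: ge0_subset_integral => //; first exact: measurable_funTS.
by move=> x /=; rewrite !in_itv/= andbT => /andP[/ltW].
Qed.

End integration.

(** * Approximation of the kernel by piecewise polynomials *)

Section local_approximation.
Variable R : realType.
Implicit Types (a b x : R).

Definition antideriv (q : {poly R}) : {poly R} :=
  \poly_(i < (size q).+1) (if i is j.+1 then q`_j / j.+1%:R else 0).

Lemma size_antideriv (q : {poly R}) : (size (antideriv q) <= (size q).+1)%N.
Proof. exact: size_poly. Qed.

Lemma deriv_antideriv (q : {poly R}) : (antideriv q)^`() = q.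
Proof.
apply/polyP => i; rewrite coef_deriv coef_poly ltnS.
case: ltnP => [iq|qi]; last by rewrite mul0rn nth_default.
by rewrite -[LHS]mulr_natr divfK// pnatr_eq0.
Qed.

(** For [y < 1] one passes to [y^-1] and [- r], so the sign of the exponent does not matter. *)
Lemma powR_le_powR2 (y r : R) : 2^-1 <= y <= 2 -> y `^ r <= 2 `^ `|r|.
Proof.
move=> /andP[y12 y2].
have y0 : 0 < y by apply: lt_le_trans y12; rewrite invr_gt0.
have H (z u : R) : 1 <= z <= 2 -> z `^ u <= 2 `^ `|u|.
  move=> /andP[z1 z2]; apply: (@le_trans _ _ (z `^ `|u|)).
    by apply: ler_powR => //; exact: ler_norm.
  by apply: ge0_ler_powR; rewrite ?nnegrE// (le_trans ler01).
have [y1|y1] := leP 1 y; first by apply: H; rewrite y1.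
rewrite -[y]invrK -(powR_inv1 (_ : 0 <= y^-1)) ?invr_ge0 ?(ltW y0)//.
rewrite -powRrM mulN1r -normrN; apply: H.
by rewrite invf_ge1// ltW//= -[2]invrK lef_pV2 ?posrE ?invr_gt0.
Qed.

(* Induction on [m]: the polynomial for [x `^ beta] is the antiderivative, exact
   at [a], of [beta] times the one for [x `^ (beta - 1)]. *)
Lemma powR_poly_approx (m : nat) : forall beta : R, exists2 K : R, 0 <= K &
  forall a b, 0 < a -> a <= b -> b <= 2 * a ->
  exists2 q : {poly R}, (size q <= m)%N &
    forall x, a <= x <= b -> `|x `^ beta - q.[x]| <= K * (b - a) ^+ m * a `^ (beta - m%:R).
Proof.
elim: m => [|m IH] beta.
  (* For [m = 0] only the zero polynomial is available, and [1 <= x / a <= 2] bounds [x^beta] by a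
     multiple of [a^beta]. *)
  exists (2 `^ `|beta|); first exact: powR_ge0.
  move=> a b a0 ab b2a; exists 0; first by rewrite size_poly0.
  move=> x /andP[ax xb]; rewrite hornerE subr0 expr0 mulr1 subr0.
  rewrite ger0_norm ?powR_ge0//.
  have xE : x = a * (x / a) by rewrite mulrC divfK// gt_eqF.
  have xa1 : 1 <= x / a by rewrite ler_pdivlMr// mul1r.
  rewrite {1}xE powRM ?(ltW a0) ?(le_trans ler01)// mulrC ler_wpM2r ?powR_ge0//.
  apply: powR_le_powR2; rewrite ler_pdivrMr// (le_trans xb)// andbT.
  by rewrite (le_trans _ xa1)// invf_le1 ?ler1n.
have [K K0 HK] := IH (beta - 1).
exists (`|beta| * K); first by rewrite mulr_ge0.
move=> a b a0 ab b2a; have [q sq Hq] := HK a b a0 ab b2a.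
pose p := beta *: antideriv q.
exists ((a `^ beta - p.[a])%:P + p).
  rewrite (leq_trans (size_polyD _ _))// geq_max (leq_trans (size_polyC_leq1 _))//=.
  by rewrite (leq_trans (size_scale_leq _ _))// (leq_trans (size_antideriv _)).
move=> x /andP[ax xb].
pose F (y : R) := y `^ beta - p.[y].
pose dF (y : R) := beta * (y `^ (beta - 1) - q.[y]).
have dFP (y : R) : 0 < y -> is_derive y 1 F (dF y).
  move=> y0.
  apply: (is_derive_eq (is_deriveB (is_derive1_powR beta y0) (is_derive_poly p y))).
  by rewrite /dF /p derivZ deriv_antideriv hornerZ mulrBr.
(* The mean value theorem turns the bound for the derivative into one with an extra factor
   [b - a]. *)
have [c /[!in_itv]/= /andP[ac cx] FE] : exists2 c, c \in `[a, x] & F x - F a = dF c * (x - a).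
  apply: MVT_segment => //.
    by move=> y; rewrite in_itv/= => /andP[ay _]; apply: dFP; exact: lt_trans ay.
  apply/subspace_continuousP => y /=; rewrite in_itv/= => /andP[ay _].
  apply: cvg_within_filter; apply/differentiable_continuous/derivable1_diffP.
  by apply: ex_derive; apply: dFP; exact: lt_le_trans ay.
have -> : x `^ beta - ((a `^ beta - p.[a])%:P + p).[x] = F x - F a.
  by rewrite hornerD hornerC /F; ring.
rewrite FE /dF normrM normrM (ger0_norm (_ : 0 <= x - a)) ?subr_ge0//.
have cab : a <= c <= b by rewrite ac (le_trans cx).
have xab : x - a <= b - a by rewrite lerD2r.
have hc := Hq c cab.
rewrite exprSr (_ : beta - m.+1%:R = beta - 1 - m%:R); last by rewrite -natr1; ring.
apply: (@le_trans _ _ (`|beta| * (K * (b - a) ^+ m * a `^ (beta - 1 - m%:R)) * (b - a))).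
  apply: ler_pM => //; rewrite ?mulr_ge0 ?subr_ge0//.
  by rewrite ler_wpM2l.
by rewrite le_eqVlt; apply/orP; left; apply/eqP; ring.
Qed.

Lemma mesh_nondecreasing T N (tau : nat -> R) : mesh T N tau ->
  forall i j, (i <= j)%N -> (j <= N)%N -> tau i <= tau j.
Proof. by move=> [_ _ nd]; apply: le_mono_upto => i iN; exact: ltW (nd i iN). Qed.

Lemma mesh_itv T N (tau : nat -> R) : mesh T N tau ->
  forall s, 0 <= s < T -> exists2 l, (l < N)%N & tau l <= s < tau l.+1.
Proof.
move=> tauP s /andP[s0 sT]; have [tau0 tauN nd] := tauP.
have ex : exists n, s < tau n by exists N; rewrite tauN.
case: (ex_minnP ex) => -[|l] sl lmin; first by move: sl; rewrite tau0 ltNge s0.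
exists l; first by apply: lmin; rewrite tauN.
by rewrite sl andbT leNgt; apply/negP => /lmin; rewrite ltnn.
Qed.

Lemma mesh_itv_uniq T N (tau : nat -> R) : mesh T N tau ->
  forall s l l', (l < N)%N -> (l' < N)%N ->
  tau l <= s < tau l.+1 -> tau l' <= s < tau l'.+1 -> l = l'.
Proof.
move=> tauP s.
suff H l l' : (l' < N)%N -> tau l <= s < tau l.+1 -> tau l' <= s < tau l'.+1 -> (l' <= l)%N.
  move=> l l' lN l'N h h'; apply/eqP; rewrite eqn_leq.
  by apply/andP; split; [exact: (H l' l)|exact: (H l l')].
move=> l'N /andP[_ sl] /andP[l's _]; rewrite leqNgt; apply/negP => ll'.
have := mesh_nondecreasing tauP ll' (ltnW l'N).
by rewrite leNgt (le_lt_trans l's sl).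
Qed.

Lemma le_mesh_size N (tau : nat -> R) l : (l < N)%N ->
  tau l.+1 - tau l <= mesh_size N tau.
Proof.
move=> lN; rewrite /mesh_size.
exact: (le_bigmax 0 (fun l : 'I_N => tau l.+1 - tau l) (Ordinal lN)).
Qed.

Lemma mesh_size_gt0 T N (tau : nat -> R) : 0 < T -> mesh T N tau -> 0 < mesh_size N tau.
Proof.
move=> T0 [tau0 tauN nd]; case: N tauN nd => [|N] tauN nd.
  by move: T0; rewrite -tauN tau0 ltxx.
by apply: lt_le_trans (le_mesh_size tau (ltn0Sn N)); rewrite subr_gt0 nd.
Qed.

(* Bounds the error of the piecewise approximant in terms of [x = t - s]: the
   approximant is [0] on the mesh intervals that come closer than [h] to the
   singularity [x = 0]. *)
Definition error_profile (gamma h : R) m (x : R) :=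
  minr (x `^ (gamma - 1)) (h ^+ m.+1 * x `^ (gamma - 1 - m.+1%:R)).

Lemma error_profile_ge0 gamma h m x : 0 <= h -> 0 <= error_profile gamma h m x.
Proof. by move=> h0; rewrite le_min powR_ge0 mulr_ge0 ?powR_ge0 ?exprn_ge0. Qed.

Lemma error_profile_le_powR gamma h m x :
  error_profile gamma h m x <= x `^ (gamma - 1).
Proof. by rewrite ge_min lexx. Qed.

Lemma error_profile_le_h gamma h m x :
  error_profile gamma h m x <= h ^+ m.+1 * x `^ (gamma - 1 - m.+1%:R).
Proof. by rewrite ge_min lexx orbT. Qed.

Lemma measurable_error_profile gamma h m : measurable_fun setT (error_profile gamma h m).
Proof.
apply: measurable_minr; first exact: measurable_powR.
by apply: measurable_funM => //; exact: measurable_powR.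
Qed.

Lemma power_kernel_approx (m : nat) (gamma : R) : exists2 K : R, 0 <= K &
  forall T t N (tau : nat -> R), 0 < T -> t <= T -> mesh T N tau ->
  exists g : R -> R, [/\ measurable_fun setT g,
    forall l, (l < N)%N -> exists2 q : {poly R}, (size q <= m.+1)%N &
      forall s, tau l <= s < tau l.+1 -> 0 <= s < t -> g s = q.[s] &
    forall s, 0 <= s < t -> `|power_kernel gamma t s - g s| <=
      K * error_profile gamma (mesh_size N tau) m (t - s)].
Proof.
pose beta := gamma - 1.
have [K0 K0ge0 HK0] := powR_poly_approx m.+1 beta.
(* The first summand serves intervals at distance at least [h] from [t], where the power of [a] is
   replaced by that of [x] with [a / x] in [[1/2, 1]]. The second serves the others, where
   [h / x >= 1/2]. *)
pose K := K0 * 2 `^ `|beta - m.+1%:R| + 2 ^+ m.+1.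
have K1 : K0 * 2 `^ `|beta - m.+1%:R| <= K by rewrite lerDl exprn_ge0.
have K2 : 2 ^+ m.+1 <= K by rewrite lerDr mulr_ge0 ?powR_ge0.
exists K; first by rewrite (le_trans _ K2)// exprn_ge0.
move=> T t N tau T0 tT tauP; set h := mesh_size N tau.
have h0 : 0 < h by exact: mesh_size_gt0 tauP.
have [tau0 tauN nd] := tauP.
(* The condition [l < N] sits under the existential so that [choice] can produce a family indexed by
   all of [nat]. *)
have Qex l : exists Q : {poly R}, (l < N)%N -> (size Q <= m.+1)%N /\
    forall s, tau l <= s < tau l.+1 -> s < t ->
      `|power_kernel gamma t s - Q.[s]| <= K * error_profile gamma h m (t - s).
  have [lN|_] := boolP (l < N)%N; last by exists 0.
  pose a := t - tau l.+1; pose b := t - tau l.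
  have bah : b - a <= h.
    by apply: le_trans (le_mesh_size tau lN); rewrite /a /b; lra.
  have ab : a <= b by have := nd _ lN; rewrite /a /b; lra.
  have [ha|ah] := leP h a.
    have a0 : 0 < a by exact: lt_le_trans ha.
    have [|q sq Hq] := HK0 a b a0 ab; first by lra.
    (* The approximant was built in [x = t - s]; composing with [t - X] returns to [s] without
       raising the degree. *)
    exists (q \Po (t%:P - 'X)) => _; split.
      rewrite (leq_trans (size_comp_poly_leq _ _))// ltnS.
      have -> : size (t%:P - 'X : {poly R}) = 2%N.
        by rewrite -opprB size_polyN size_XsubC.
      by rewrite muln1; case: (size q) sq.
    move=> s /andP[ls sl] st; rewrite horner_comp !hornerE /power_kernel.
    pose x := t - s; rewrite -/x -/beta.
    have ax : a <= x by rewrite /a /x; lra.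
    have xb : x <= b by rewrite /b /x; lra.
    have x0 : 0 < x by exact: lt_le_trans ax.
    apply: le_trans (Hq x _) _; first by rewrite ax.
    have vE : h ^+ m.+1 * x `^ (beta - m.+1%:R) = (h / x) ^+ m.+1 * x `^ beta.
      rewrite powRB; last by rewrite (gt_eqF x0) implybT.
      by rewrite powR_mulrn ?(ltW x0)// expr_div_n; ring.
    have hx1 : h / x <= 1 by rewrite ler_pdivrMr// mul1r (le_trans ha).
    have uv : h ^+ m.+1 * x `^ (beta - m.+1%:R) <= x `^ beta.
      by rewrite vE ler_piMl ?powR_ge0// exprn_ile1// divr_ge0 ?(ltW h0) ?(ltW x0).
    rewrite /error_profile -/beta (min_idPr uv).
    apply: (@le_trans _ _ (K0 * h ^+ m.+1 * (2 `^ `|beta - m.+1%:R| * x `^ (beta - m.+1%:R)))).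
      apply: ler_pM; rewrite ?mulr_ge0 ?exprn_ge0 ?powR_ge0 ?subr_ge0//.
        by rewrite ler_wpM2l// lerXn2r ?nnegrE ?subr_ge0// ltW.
      rewrite [in leLHS](_ : a = a / x * x); last by rewrite divfK// gt_eqF.
      rewrite powRM ?divr_ge0 ?(ltW a0) ?(ltW x0)// ler_wpM2r ?powR_ge0//.
      apply: powR_le_powR2; rewrite ler_pdivlMr// ler_pdivrMr//.
      by apply/andP; split; lra.
    rewrite mulrACA ler_wpM2r//.
    by rewrite mulr_ge0 ?powR_ge0// exprn_ge0// ltW.
  (* This case also covers the intervals reaching beyond [t], for which [a] is negative. Both
     branches of the profile are at least [2^-(m+1)] times the kernel. *)
  exists 0 => _; split; first by rewrite size_poly0.
  move=> s /andP[ls sl] st; rewrite hornerE subr0 ger0_norm ?powR_ge0//.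
  pose x := t - s; rewrite /power_kernel -/x -/beta.
  have x0 : 0 < x by rewrite subr_gt0.
  have x2h : x <= 2 * h by move: ah bah; rewrite /a /b /x; lra.
  have vE : h ^+ m.+1 * x `^ (beta - m.+1%:R) = (h / x) ^+ m.+1 * x `^ beta.
    rewrite powRB; last by rewrite (gt_eqF x0) implybT.
    by rewrite powR_mulrn ?(ltW x0)// expr_div_n; ring.
  apply: le_trans (ler_wpM2r _ K2); last by apply: error_profile_ge0; exact: ltW.
  rewrite -ler_pdivrMl ?exprn_gt0// /error_profile -/beta le_min vE.
  rewrite -exprVn ler_wpM2r ?powR_ge0// ?andbT ?ler_piMl ?powR_ge0//=.
    by rewrite exprn_ile1// ?invr_ge0 ?invf_le1 ?ler1n.
  rewrite lerXn2r ?nnegrE ?invr_ge0 ?divr_ge0 ?(ltW h0) ?(ltW x0)//.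
  by rewrite ler_pdivlMr// ler_pdivrMl.
have [Q QP] := choice Qex.
pose g (s : R) := \sum_(l < N) (\1_`[tau l, tau l.+1[ s : R) * (Q l).[s].
have gE s l : (l < N)%N -> tau l <= s < tau l.+1 -> g s = (Q l).[s].
  move=> lN sl; rewrite /g (bigD1 (Ordinal lN))//= big1 ?addr0.
    by rewrite indicE mem_setE in_itv/= sl mul1r.
  move=> i il; rewrite indicE mem_setE in_itv/=.
  case: (boolP (tau i <= s < tau i.+1)) => si; last by rewrite mul0r.
  by case/eqP: il; apply/val_inj/esym; exact: (mesh_itv_uniq tauP) si.
exists g; split.
- apply: measurable_sum => l; apply: measurable_funM; first exact: measurable_indic.
  by apply: continuous_measurable_fun; exact: continuous_horner.
- by move=> l lN; exists (Q l) => [|s sl _]; [have [] := QP l lN|exact: gE].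
- move=> s /andP[s0 st]; have [|l lN sl] := mesh_itv tauP (s := s).
    by rewrite s0 (lt_le_trans st).
  by rewrite (gE s l lN sl); have [_] := QP l lN; apply.
Qed.

End local_approximation.

(** * The integral of the squared error profile *)

Section error_integral.
Variable R : realType.
Implicit Types (gamma t h : R) (m : nat).
Local Notation leb := (@lebesgue_measure R).

Lemma delta_ge1 gamma m t h : 1 <= delta gamma m t h.
Proof. by rewrite /delta; case: ifP => // _; rewrite lerDl sqrtr_ge0. Qed.

Lemma error_profile_sqr_le_powR gamma h m x : 0 < h ->
  error_profile gamma h m x ^+ 2 <= x `^ (2 * gamma - 2).
Proof.
move=> h0; apply: (@le_trans _ _ ((x `^ (gamma - 1)) ^+ 2)).
  by rewrite lerXn2r ?nnegrE ?powR_ge0 ?error_profile_ge0 ?(ltW h0)// error_profile_le_powR.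
by rewrite -powR_mulrn ?powR_ge0// -powRrM (_ : (gamma - 1) * 2 = 2 * gamma - 2)//; ring.
Qed.

Lemma error_profile_sqr_le_h gamma h m x : 0 < h ->
  error_profile gamma h m x ^+ 2 <=
  h `^ (2 * m + 2)%:R * x `^ (2 * gamma - 2 - (2 * m + 2)%:R).
Proof.
move=> h0; apply: (@le_trans _ _ ((h ^+ m.+1 * x `^ (gamma - 1 - m.+1%:R)) ^+ 2)).
  rewrite lerXn2r ?nnegrE ?mulr_ge0 ?powR_ge0 ?exprn_ge0 ?error_profile_ge0 ?(ltW h0)//.
  exact: error_profile_le_h.
rewrite exprMn -exprM -[X in _ * X]powR_mulrn ?powR_ge0// -powRrM.
rewrite powR_mulrn ?(ltW h0)// (_ : (m.+1 * 2 = 2 * m + 2)%N); last by rewrite mulnC mulnS addnC.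
rewrite (_ : (gamma - 1 - m.+1%:R) * 2 = 2 * gamma - 2 - (2 * m + 2)%:R)//.
by rewrite natrD natrM -natr1; ring.
Qed.

Let mE2 gamma h m (D : set R) :
  measurable_fun D (fun x => (error_profile gamma h m x ^+ 2)%:E).
Proof.
by apply/measurable_EFinP/measurable_funTS/measurable_funX; exact: measurable_error_profile.
Qed.

Let E2_ge0 gamma h m x : (0 <= (error_profile gamma h m x ^+ 2)%:E)%E.
Proof. by rewrite lee_fin sqr_ge0. Qed.

Lemma integral_error_profile_near gamma h m c : 2^-1 < gamma -> 0 < h -> 0 <= c ->
  (\int[leb]_(x in `]0%R, c]) (error_profile gamma h m x ^+ 2)%:E <=
   (c `^ (2 * gamma - 1) / (2 * gamma - 1))%:E)%E.
Proof.
move=> g12 h0 c0.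
have -> : 2 * gamma - 1 = 2 * gamma - 2 + 1 by ring.
apply: le_trans (integral_powR_le (_ : 0 < 2 * gamma - 2 + 1) c0); last by lra.
apply: ge0_le_integral => //; [exact: mE2|exact: measurable_powR_EFin|].
by move=> x _; rewrite lee_fin error_profile_sqr_le_powR.
Qed.

Lemma integral_error_profile_far gamma h m t : 0 < h -> h < t ->
  (\int[leb]_(x in `[h, t]) (error_profile gamma h m x ^+ 2)%:E <=
   (h `^ (2 * m + 2)%:R)%:E *
   \int[leb]_(x in `[h, t]) (x `^ (2 * gamma - 2 - (2 * m + 2)%:R))%:E)%E.
Proof.
move=> h0 ht; rewrite -ge0_integralZl//; last 3 first.
- exact: measurable_powR_EFin.
- by move=> x _; rewrite lee_fin powR_ge0.
- by rewrite lee_fin powR_ge0.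
apply: ge0_le_integral => //; first exact: mE2.
  by apply/measurable_EFinP/measurable_funTS/measurable_funM => //; exact: measurable_powR.
by move=> x _; rewrite -EFinM lee_fin error_profile_sqr_le_h.
Qed.

Lemma integral_error_profile_split gamma h m t : 0 < h -> h < t ->
  (\int[leb]_(x in `]0%R, t]) (error_profile gamma h m x ^+ 2)%:E <=
   \int[leb]_(x in `]0%R, h]) (error_profile gamma h m x ^+ 2)%:E +
   \int[leb]_(x in `[h, t]) (error_profile gamma h m x ^+ 2)%:E)%E.
Proof.
move=> h0 ht.
have -> : `]0%R, t]%classic = `]0%R, h] `|` `]h, t] :> set R.
  apply/seteqP; split => x /=; rewrite !in_itv/=.
    by move=> /andP[-> ->]; rewrite andbT; have [_|_] := leP x h; [left|right].
  by case=> /andP[a b]; apply/andP; split => //; [rewrite (le_trans b)// ltW|exact: lt_trans a].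
rewrite ge0_integral_setU//; last first.
  apply/disj_set2P; apply/seteqP; split => x //=; rewrite !in_itv/=.
  by case=> /andP[_ xh] /andP[]; rewrite ltNge xh.
- exact: mE2.
rewrite leeD2l//; apply: ge0_subset_integral => //; first exact: mE2.
by move=> x /=; rewrite !in_itv/= => /andP[/ltW -> ->].
Qed.

(** With [a = 2 gamma - 1] and [k = 2 m + 2], the two branches squared are [x^(a-1)] and
    [h^k x^(a-k-1)], and the sign of [a - k] decides where the integral concentrates. *)
Lemma integral_error_profile gamma m t : 2^-1 < gamma ->
  exists2 C : R, 0 <= C & forall h, 0 < h -> 0 <= t ->
  (\int[leb]_(x in `]0%R, t]) (error_profile gamma h m x ^+ 2)%:E <=
   (C * delta gamma m t h ^+ 2 * h `^ minr (2 * gamma - 1) (2 * m + 2)%:R)%:E)%E.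
Proof.
move=> g12; set a := 2 * gamma - 1; set k : R := (2 * m + 2)%:R.
have a0 : 0 < a by rewrite /a; lra.
have kE : k = 2 * m%:R + 2 by rewrite /k natrD natrM.
have aE : 2 * gamma - 2 - k + 1 = a - k by rewrite /a; ring.
have d1 h : 1 <= delta gamma m t h ^+ 2 by rewrite exprn_ege1// delta_ge1.
have near0 h : 0 < h -> 0 <= t -> t <= h ->
    (\int[leb]_(x in `]0%R, t]) (error_profile gamma h m x ^+ 2)%:E <= (a^-1 * h `^ a)%:E)%E.
  move=> h0 t0 th; apply: le_trans (integral_error_profile_near _ g12 h0 t0) _.
  rewrite lee_fin -/a mulrC ler_wpM2l ?invr_ge0 ?(ltW a0)//.
  by apply: ge0_ler_powR; rewrite ?nnegrE ?(ltW a0)// ltW.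
(* If [k < a], the second branch is square integrable down to 0 and serves on all of []0, t]]; the
   constant picks up a power of [t]. *)
have [ka|ak] := ltP k a.
  exists (t `^ (a - k) / (a - k)); first by rewrite divr_ge0 ?powR_ge0 ?subr_ge0// ltW.
  move=> h h0 t0.
  apply: (@le_trans _ _ ((h `^ k)%:E * \int[leb]_(x in `]0%R, t]) (x `^ (2 * gamma - 2 - k))%:E)%E).
    rewrite -ge0_integralZl//; last 3 first.
    - exact: measurable_powR_EFin.
    - by move=> x _; rewrite lee_fin powR_ge0.
    - by rewrite lee_fin powR_ge0.
    apply: ge0_le_integral => //; first exact: mE2.
      by apply/measurable_EFinP/measurable_funTS/measurable_funM => //; exact: measurable_powR.
    by move=> x _; rewrite -EFinM lee_fin error_profile_sqr_le_h.
  apply: (@le_trans _ _ ((h `^ k)%:E * (t `^ (a - k) / (a - k))%:E)%E).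
    rewrite lee_wpmul2l ?lee_fin ?powR_ge0// -aE; apply: integral_powR_le => //.
    by rewrite aE subr_gt0.
  rewrite -EFinM lee_fin mulrC ler_wpM2r ?powR_ge0// ler_peMr//.
  by rewrite divr_ge0 ?powR_ge0 ?subr_ge0// ltW.
(* At the critical exponent the far part integrates [x^-1]. The square of [delta] enters through
   [1/a + L <= (1/a + 1) (1 + sqrt L)^2] with [L = ln (t / h)]. *)
have [ak'|ak'] := eqVneq a k.
  exists (a^-1 + 1); first by rewrite addr_ge0 ?invr_ge0 ?(ltW a0).
  move=> h h0 t0.
  have gE : gamma = m%:R + 3 / 2 by move: ak'; rewrite /a kE; lra.
  have [th|ht] := leP t h.
    apply: le_trans (near0 h h0 t0 th) _; rewrite lee_fin ler_wpM2r ?powR_ge0//.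
    apply: (@le_trans _ _ (a^-1 + 1)); first by rewrite lerDl.
    by rewrite ler_peMr// addr_ge0 ?invr_ge0 ?(ltW a0).
  apply: le_trans (integral_error_profile_split _ _ h0 ht) _.
  apply: (@le_trans _ _ ((h `^ a / a)%:E + (h `^ k)%:E * (ln (t / h))%:E)%E).
    apply: leeD; first exact: integral_error_profile_near (ltW h0).
    apply: le_trans (integral_error_profile_far _ _ h0 ht) _.
    rewrite -/k -integral_inv_itv// lee_wpmul2l ?lee_fin ?powR_ge0//.
    rewrite le_eqVlt; apply/orP; left; apply/eqP; apply: eq_integral => x.
    rewrite inE/= in_itv/= => /andP[hx _]; congr EFin.
    rewrite -powR_inv1 ?(le_trans (ltW h0))//; congr (_ `^ _).
    by rewrite -ak' /a; ring.
  have L0 : 0 <= ln (t / h) by rewrite ln_ge0// ler_pdivlMr// mul1r ltW.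
  rewrite -EFinM -EFinD lee_fin -ak' /delta gE eqxx.
  have -> : h `^ a / a + h `^ a * ln (t / h) = (a^-1 + ln (t / h)) * h `^ a by ring.
  rewrite ler_wpM2r ?powR_ge0//.
  have s0 := sqrtr_ge0 (ln (t / h)); have sE := sqr_sqrtr L0.
  set sq := Num.sqrt _ in s0 sE *; rewrite -sE.
  have aV : 0 <= a^-1 by rewrite invr_ge0 ltW.
  have : 0 <= a^-1 * (2 * sq + sq ^+ 2) by rewrite mulr_ge0// addr_ge0 ?mulr_ge0 ?sqr_ge0.
  have -> : (a^-1 + 1) * (1 + sq) ^+ 2 = a^-1 + a^-1 * (2 * sq + sq ^+ 2) + 1 + 2 * sq + sq ^+ 2 by ring.
  lra.
(* Now the far integral is dominated by its lower end [h], so both parts are of order [h^a]. *)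
have {}ak : a < k by rewrite lt_neqAle ak'.
have C0 : 0 <= a^-1 by rewrite invr_ge0 ltW.
have C1 : 0 <= (k - a)^-1 by rewrite invr_ge0 subr_ge0 ltW.
exists (a^-1 + (k - a)^-1); first exact: addr_ge0.
move=> h h0 t0.
apply: (@le_trans _ _ ((a^-1 + (k - a)^-1) * h `^ a)%:E); last first.
  by rewrite lee_fin ler_wpM2r ?powR_ge0// ler_peMr// addr_ge0.
have [th|ht] := leP t h.
  apply: le_trans (near0 h h0 t0 th) _.
  by rewrite lee_fin ler_wpM2r ?powR_ge0// lerDl.
apply: le_trans (integral_error_profile_split _ _ h0 ht) _.
rewrite mulrDl EFinD; apply: leeD.
  by rewrite mulrC; apply: integral_error_profile_near => //; exact: ltW.
apply: le_trans (integral_error_profile_far _ _ h0 ht) _.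
rewrite -/k integral_powR_itv// aE ?subr_eq0 ?lt_eqF// -EFinM lee_fin.
have -> : h `^ a = h `^ k * h `^ (a - k).
  by rewrite -powRD ?subrKC// (gt_eqF h0) implybT.
rewrite [leRHS]mulrCA ler_wpM2l ?powR_ge0//.
have -> : (t `^ (a - k) - h `^ (a - k)) / (a - k) = (k - a)^-1 * (h `^ (a - k) - t `^ (a - k)).
  by rewrite -[X in _ / X](opprB k a) invrN mulrN -mulNr opprB mulrC.
by rewrite ler_wpM2l// gerBl powR_ge0.
Qed.

End error_integral.

Local Instance ae_lebesgue_filter (R : realType) :
  Filter (nbhs (almost_everywhere (@lebesgue_measure R))).
Proof. exact: (ae_filter_ringOfSetsType (@lebesgue_measure R)). Qed.

Local Instance ae_leb_upto_filter (R : realType) (t : R) :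
  Filter (nbhs (almost_everywhere (leb_upto t))).
Proof. exact: (ae_filter_ringOfSetsType (leb_upto t)). Qed.

Section ae_Lnorm.
Context d (T : measurableType d) (R : realType).
Variable mu : {measure set T -> \bar R}.
Implicit Types (f g : T -> R).

Lemma ae_le_Lnorm (p : \bar R) f g : (1 <= p)%E ->
  measurable_fun setT f -> measurable_fun setT g ->
  {ae mu, forall x, `|f x| <= `|g x|} ->
  ('N[mu]_p[EFin \o f] <= 'N[mu]_p[EFin \o g])%E.
Proof.
move=> p1 mf mg fg; rewrite unlock; case: p p1 => [r r1| |//].
  have r0 : 0 < r by rewrite -lte_fin (lt_le_trans _ r1)// lte01.
  have mr (u : T -> R) : measurable_fun setT u ->
      measurable_fun setT (fun x => (`|u x| `^ r)%:E).
    move=> mu'; apply/measurable_EFinP.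
    apply: (@measurableT_comp _ _ _ _ _ _ (@powR R ^~ r)) => //.
    exact: measurableT_comp.
  apply: gt0_ler_poweR; rewrite ?in_itv/= ?leey ?andbT ?invr_ge0 ?(ltW r0)//.
  - by apply: integral_ge0 => x _; rewrite lee_fin powR_ge0.
  - by apply: integral_ge0 => x _; rewrite lee_fin powR_ge0.
  apply: ae_ge0_le_integral => //; [exact: mr|exact: mr|].
  apply: filterS fg => x fgx _; rewrite lee_fin.
  by apply: ge0_ler_powR; rewrite ?nnegrE ?(ltW r0).
move=> _; case: ifPn => // _; apply: le_ess_sup.
by apply: filterS fg => x fgx; rewrite /= lee_fin.
Qed.

Lemma ae_eq_Lnorm (p : \bar R) f g : (1 <= p)%E ->
  measurable_fun setT f -> measurable_fun setT g ->
  {ae mu, forall x, f x = g x} ->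
  ('N[mu]_p[EFin \o f] = 'N[mu]_p[EFin \o g])%E.
Proof.
move=> p1 mf mg fg; apply/eqP; rewrite eq_le; apply/andP; split.
  by apply: ae_le_Lnorm => //; apply: filterS fg => x ->.
by apply: ae_le_Lnorm => //; apply: filterS fg => x ->.
Qed.

End ae_Lnorm.

Section projection_error.
Variable R : realType.
Implicit Types (gamma t : R) (m : nat).

Lemma ae_leb_upto t : {ae leb_upto t, forall s, 0 <= s < t}.
Proof.
exists (~` `[0, t[%classic); split.
- exact: measurableC.
- by apply: etrans (measure0 (@lebesgue_measure R)); congr (lebesgue_measure _); exact: setICl.
- by move=> x /= h; rewrite in_itv/=.
Qed.

Lemma le_integral_leb_upto t (F G : R -> R) :
  measurable_fun setT F -> measurable_fun setT G -> (forall x, 0 <= F x) ->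
  (forall x, 0 <= G x) -> (forall s, 0 <= s < t -> F s <= G s) ->
  (\int[leb_upto t]_s (F s)%:E <= \int[leb_upto t]_s (G s)%:E)%E.
Proof.
move=> mF mG F0 G0 FG; apply: ae_ge0_le_integral => //.
- by move=> x _; rewrite lee_fin.
- exact/measurable_EFinP.
- by move=> x _; rewrite lee_fin.
- exact/measurable_EFinP.
- by have := ae_leb_upto t; apply: filterS => s st _; rewrite lee_fin FG.
Qed.

Lemma measurable_power_kernel gamma t : measurable_fun setT (power_kernel gamma t).
Proof.
apply: (measurableT_comp (measurable_powR _)); exact: measurable_funB.
Qed.

Lemma L2_power_kernel gamma t : 2^-1 < gamma -> 0 <= t ->
  L2 (leb_upto t) (power_kernel gamma t).
Proof.
move=> g12 t0; apply/L2P; split; first exact: measurable_power_kernel.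
rewrite (integral_leb_upto_reflect t (f := fun x => ((x `^ (gamma - 1)) ^+ 2)%:E)); last 2 first.
- by apply/measurable_EFinP/measurable_funX; exact: measurable_powR.
- by move=> x; rewrite lee_fin sqr_ge0.
under eq_integral do rewrite -powR_mulrn ?powR_ge0// -powRrM.
by apply: le_lt_trans (integral_powR_le _ t0) _; [lra|rewrite ltry].
Qed.

Section mesh_approximation.
Variables (gamma t T : R) (N : nat) (tau : nat -> R) (m : nat).
Variables (g : R -> R) (K : R).
Hypotheses (T0 : 0 < T) (t0 : 0 <= t) (tauP : mesh T N tau) (K0 : 0 <= K).
Hypothesis mg : measurable_fun setT g.
Hypothesis gP : forall s, 0 <= s < t -> `|power_kernel gamma t s - g s| <=
  K * error_profile gamma (mesh_size N tau) m (t - s).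
Let h := mesh_size N tau.
Let h0 : 0 < h. Proof. exact: mesh_size_gt0 T0 tauP. Qed.

Let mB : measurable_fun setT (fun s => power_kernel gamma t s - g s).
Proof. by apply: measurable_funB => //; exact: measurable_power_kernel. Qed.

Lemma integral_mesh_error_le :
  (\int[leb_upto t]_s ((power_kernel gamma t s - g s) ^+ 2)%:E <=
   (K ^+ 2)%:E * \int[lebesgue_measure]_(x in `]0%R, t]) (error_profile gamma h m x ^+ 2)%:E)%E.
Proof.
have mE : measurable_fun setT (fun s : R => error_profile gamma h m (t - s)).
  by apply: (measurableT_comp (measurable_error_profile _ _ _)); exact: measurable_funB.
rewrite -(integral_leb_upto_reflect t (f := fun x => (error_profile gamma h m x ^+ 2)%:E)); last 2 first.
- by apply/measurable_EFinP/measurable_funX; exact: measurable_error_profile.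
- by move=> x; rewrite lee_fin sqr_ge0.
rewrite -ge0_integralZl//; last 3 first.
- by apply/measurable_EFinP/measurable_funX.
- by move=> x _; rewrite lee_fin sqr_ge0.
- by rewrite lee_fin sqr_ge0.
under [leRHS]eq_integral do rewrite -EFinM -exprMn.
apply: le_integral_leb_upto => //; try by move=> x; rewrite sqr_ge0.
- exact: measurable_funX.
- by apply: measurable_funX; exact: measurable_funM.
move=> s st; rewrite -real_normK ?num_real// lerXn2r ?nnegrE ?gP//.
by rewrite mulr_ge0// error_profile_ge0// ltW.
Qed.

(** Membership follows from the error estimate: [g] is the kernel minus the error, both square
    integrable. *)
Lemma L2_mesh_approx : 2^-1 < gamma -> L2 (leb_upto t) g.
Proof.
move=> g12; have Lf := L2_power_kernel g12 t0.
suff Lr : L2 (leb_upto t) (fun s => power_kernel gamma t s - g s).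
  rewrite (_ : g = fun s => power_kernel gamma t s - (power_kernel gamma t s - g s)).
    exact: L2B.
  by apply/funext => s; rewrite subKr.
apply/L2P; split => //; apply: le_lt_trans integral_mesh_error_le _.
have [C C0 HC] := integral_error_profile m t g12.
apply: le_lt_trans (lee_wpmul2l _ (HC h h0 t0)) _; first by rewrite lee_fin sqr_ge0.
by rewrite -EFinM ltry.
Qed.

(** The exponent condition makes the [h^(m+1)] branch [r]-integrable at the singularity, so that
    branch alone bounds the error everywhere. *)
Lemma Lnorm_mesh_error_le (r : R) : 1 <= r -> 0 < (gamma - 1 - m.+1%:R) * r + 1 ->
  ('N[leb_upto t]_r%:E[EFin \o (fun s => power_kernel gamma t s - g s)%R] <=
   (K * h ^+ m.+1 * (t `^ ((gamma - 1 - m.+1%:R) * r + 1) /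
     ((gamma - 1 - m.+1%:R) * r + 1)) `^ r^-1)%:E)%E.
Proof.
move=> r1 E0; set E := _ * r in E0 *; have r0 : 0 < r by apply: lt_le_trans r1.
pose u s := K * h ^+ m.+1 * (t - s) `^ (gamma - 1 - m.+1%:R).
have c0 : 0 <= K * h ^+ m.+1 by rewrite mulr_ge0// exprn_ge0// ltW.
have u0 s : 0 <= u s by rewrite mulr_ge0 ?powR_ge0.
have mu : measurable_fun setT u.
  apply: measurable_funM => //; apply: (measurableT_comp (measurable_powR _)).
  exact: measurable_funB.
apply: (@le_trans _ _ ('N[leb_upto t]_r%:E[EFin \o u])%E).
  apply: ae_le_Lnorm => //; have := ae_leb_upto t; apply: filterS => s st.
  rewrite (ger0_norm (u0 s)); apply: le_trans (gP st) _.
  by rewrite /u -mulrA ler_wpM2l//; exact: error_profile_le_h.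
rewrite unlock.
have -> : (\int[leb_upto t]_x (`|(EFin \o u) x| `^ r) =
    \int[leb_upto t]_x (((K * h ^+ m.+1) `^ r)%:E * ((t - x) `^ E)%:E))%E.
  apply: eq_integral => x _; rewrite /= ger0_norm// /u powRM ?powR_ge0//.
  by rewrite -powRrM EFinM.
have mG : measurable_fun setT (fun x : R => (x `^ E)%:E) by exact: measurable_powR_EFin.
rewrite ge0_integralZl//; last 3 first.
- by apply: (measurableT_comp mG); exact: measurable_funB.
- by move=> x _; rewrite lee_fin powR_ge0.
- by rewrite lee_fin powR_ge0.
rewrite (integral_leb_upto_reflect t mG); last by move=> x; rewrite lee_fin powR_ge0.
have I0 : (0 <= \int[lebesgue_measure]_(x in `]0%R, t]) (x `^ E)%:E)%E.
  by apply: integral_ge0 => x _; rewrite lee_fin powR_ge0.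
rewrite poweRM ?lee_fin ?powR_ge0// poweR_EFin -powRrM divff ?gt_eqF// powRr1//.
rewrite [leRHS]EFinM lee_wpmul2l ?lee_fin// -poweR_EFin.
apply: gt0_ler_poweR; rewrite ?in_itv/= ?leey ?andbT ?invr_ge0 ?(ltW r0)//.
  by rewrite lee_fin divr_ge0 ?powR_ge0// ltW.
exact: integral_powR_le.
Qed.

Lemma Linfty_mesh_error_le : 0 < gamma - 1 - m.+1%:R ->
  ('N[leb_upto t]_+oo[EFin \o (fun s => power_kernel gamma t s - g s)%R] <=
   (K * h ^+ m.+1 * t `^ (gamma - 1 - m.+1%:R))%:E)%E.
Proof.
move=> E0; rewrite unlock; case: ifPn => _; last first.
  by rewrite lee_fin mulr_ge0 ?powR_ge0// mulr_ge0// exprn_ge0// ltW.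
apply/ess_supP; have := ae_leb_upto t; apply: filterS => s st.
rewrite /= lee_fin; apply: le_trans (gP st) _; rewrite -mulrA ler_wpM2l//.
apply: le_trans (error_profile_le_h _ _ _ _) _; rewrite ler_wpM2l ?exprn_ge0 ?(ltW h0)//.
have /andP[s0 s_t] := st.
by apply: ge0_ler_powR; rewrite ?nnegrE ?subr_ge0 ?(ltW s_t) ?(ltW E0)//; lra.
Qed.

End mesh_approximation.

(* The constant may be chosen independently of [m]: if [gamma < m0 + 3 / 2], then
   degree [m0] already yields the rate for every [m >= m0]. *)
Lemma power_kernel_L2_approx gamma t : exists2 K : R, 0 <= K &
  forall T m N (tau : nat -> R), 2^-1 < gamma -> 0 < T -> 0 <= t <= T -> mesh T N tau ->
  exists2 g : R -> R, piecewise_poly t m N tau g &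
    (\int[leb_upto t]_s ((power_kernel gamma t s - g s) ^+ 2)%:E <=
     (K * delta gamma m t (mesh_size N tau) ^+ 2 *
      mesh_size N tau `^ minr (2 * gamma - 1) (2 * m + 2)%:R)%:E)%E.
Proof.
(* The hypothesis on [gamma] stands after the constant, so that the constant is a total function of
   [gamma] and [t]. *)
have [g12|_] := ltP 2^-1 gamma; last by exists 0.
have [m0 m0P] : exists m0 : nat, gamma < m0%:R + 3 / 2.
  exists (Num.bound `|gamma|); apply: (@le_lt_trans _ _ `|gamma|); first exact: ler_norm.
  by apply: lt_le_trans (archi_boundP (normr_ge0 _)) _; rewrite lerDl.
have Kex (j : nat) : exists K : R, 0 <= K /\
    forall T N (tau : nat -> R), 0 < T -> 0 <= t <= T -> mesh T N tau ->
    exists2 g : R -> R, piecewise_poly t j N tau g &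
      (\int[leb_upto t]_s ((power_kernel gamma t s - g s) ^+ 2)%:E <=
       (K * delta gamma j t (mesh_size N tau) ^+ 2 *
        mesh_size N tau `^ minr (2 * gamma - 1) (2 * j + 2)%:R)%:E)%E.
  have [K K0 HK] := power_kernel_approx j gamma.
  have [C C0 HC] := integral_error_profile j t g12.
  exists (K ^+ 2 * C); split; first by rewrite mulr_ge0 ?sqr_ge0.
  move=> T N tau T0 /andP[t0 tT] tauP.
  have [g [mg gq gP]] := HK T t N tau T0 tT tauP.
  exists g.
    split; first exact: (L2_mesh_approx T0 t0 tauP K0 mg gP g12).
    move=> l lN; have [q sq qP] := gq l lN; exists q => //.
    by apply: aeW => s sl st; exact: qP.
  apply: le_trans (integral_mesh_error_le T0 tauP K0 mg gP) _.
  apply: le_trans (lee_wpmul2l _ (HC _ (mesh_size_gt0 T0 tauP) t0)) _.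
    by rewrite lee_fin sqr_ge0.
  by rewrite -EFinM !mulrA.
have [K /all_and2[K0 HK]] := choice Kex.
exists (\sum_(j < m0.+1) K j); first by apply: sumr_ge0.
move=> T m N tau _ T0 tT tauP; set h := mesh_size N tau.
have h0 : 0 < h by exact: mesh_size_gt0 T0 tauP.
pose j := minn m m0.
have jm0 : (j < m0.+1)%N by rewrite ltnS geq_minr.
have Kj : K j <= \sum_(i < m0.+1) K i.
  by rewrite (bigD1 (Ordinal jm0))//= lerDl sumr_ge0.
have [g [Lg gq] gE] := HK j T N tau T0 tT tauP.
exists g.
  split=> // l lN; have [q sq qP] := gq l lN; exists q => //.
  by rewrite (leq_trans sq)// ltnS geq_minl.
apply: le_trans gE _; rewrite lee_fin -/h.
apply: ler_pM; rewrite ?powR_ge0//; first by rewrite mulr_ge0 ?sqr_ge0.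
  apply: ler_pM; rewrite ?sqr_ge0//; rewrite lerXn2r ?nnegrE ?(le_trans ler01 (delta_ge1 _ _ _ _))//.
  rewrite /j; case: leqP => [//|m0m].
  (* For [m > m0] the approximant of degree [m0] is reused; as [gamma < m0 + 3/2], its [delta] is 1
     and, below, both minima equal [2 gamma - 1]. *)
  by rewrite {1}/delta lt_eqF// delta_ge1.
rewrite /j; case: leqP => [//|m0m].
have e1 : 2 * gamma - 1 <= (2 * m0 + 2)%:R by rewrite natrD natrM; lra.
have e2 : 2 * gamma - 1 <= (2 * m + 2)%:R.
  by apply: le_trans e1 _; rewrite ler_nat leq_add2r leq_mul2l ltnW.
by rewrite (min_idPl e1) (min_idPl e2).
Qed.

End projection_error.

(** * Projection error and weights *)

Section quasi_optimality.
Variables (R : realType) (gamma t : R) (m N : nat) (tau : nat -> R).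
Variables (domPi : set (R -> R)) (Pi : (R -> R) -> R -> R).
Hypotheses (g12 : 2^-1 < gamma) (t0 : 0 <= t).
Hypothesis linPi : linear_operator (leb_upto t) domPi Pi.
Hypothesis Pi_poly : forall chi, domPi chi -> piecewise_poly t m N tau (Pi chi).
Hypothesis Pi_id : forall g, piecewise_poly t m N tau g -> Pi g = g %[ae leb_upto t].
Hypothesis dom_approx : approx_space gamma t m N tau `<=` domPi.
Let f := power_kernel gamma t.

Lemma piecewise_poly0 : piecewise_poly t m N tau (fun=> 0).
Proof.
split; first exact: L20.
by move=> l _; exists 0; [rewrite size_poly0|apply: aeW => s _ _; rewrite hornerE].
Qed.

Lemma dom_power_kernel : domPi f.
Proof.
apply: dom_approx; exists (fun=> 0); first exact: piecewise_poly0.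
by exists 1; apply/funext => s; rewrite add0r mul1r.
Qed.

Lemma L2_projection : L2 (leb_upto t) (Pi f).
Proof. by have [] := Pi_poly dom_power_kernel. Qed.

(** The exponent is left general because the estimate serves both bounds. Stability is available on
    the approximation space only, which contains [f - g] and is where [Pi] is applied. *)
Lemma projection_error_le (p : \bar R) (C : R) (g : R -> R) : (1 <= p)%E -> 0 <= C ->
  (forall chi, approx_space gamma t m N tau chi ->
    ('N[leb_upto t]_p[EFin \o Pi chi] <= C%:E * 'N[leb_upto t]_p[EFin \o chi])%E) ->
  piecewise_poly t m N tau g ->
  ('N[leb_upto t]_p[EFin \o (fun s => f s - Pi f s)%R] <=
   (1 + C)%:E * 'N[leb_upto t]_p[EFin \o (fun s => f s - g s)%R])%E.
Proof.
move=> p1 C0 PiC gP; have [Lg gq] := gP.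
pose chi (s : R) := -1 * g s + f s.
have chiA : approx_space gamma t m N tau chi.
  exists (fun s => -1 * g s).
    split; first exact: L2Z.
    move=> l lN; have [q sq qP] := gq l lN; exists (-1 *: q).
      by rewrite (leq_trans (size_scale_leq _ _)).
    by apply: filterS qP => s qs sl st; rewrite hornerZ qs.
  by exists 1; apply/funext => s; rewrite mul1r.
have domg : domPi g.
  by apply: dom_approx; exists g => //; exists 0; apply/funext => s; rewrite mul0r addr0.
have [_ _ _ _ /(_ (-1) g f domg dom_power_kernel) PiE] := linPi.
have mf := measurable_power_kernel gamma t.
have mg := L2_measurable Lg; have mPif := L2_measurable L2_projection.
have mchi : measurable_fun setT chi by apply: measurable_funD => //; exact: measurable_funM.
have mPichi : measurable_fun setT (Pi chi).
  by have [/L2_measurable] := Pi_poly (dom_approx chiA).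
have chiE : chi = (fun s => f s - g s) by apply/funext => s; rewrite /chi mulN1r addrC.
have -> : ('N[leb_upto t]_p[EFin \o (fun s => f s - Pi f s)%R] =
    'N[leb_upto t]_p[EFin \o (chi \- Pi chi)%R])%E.
  apply: ae_eq_Lnorm => //; [exact: measurable_funB|exact: measurable_funB|].
  have Pig := Pi_id gP; move: PiE Pig; apply: filterS2 => s + + /=.
  rewrite -/chi => /(_ I) -> /(_ I) ->.
  by rewrite /chi; ring.
apply: (@le_trans _ _ ('N[leb_upto t]_p[EFin \o chi] + 'N[leb_upto t]_p[EFin \o Pi chi])%E).
  have := @eminkowski _ _ _ (leb_upto t) chi (fun s => - Pi chi s) p mchi _ p1.
  have -> : ('N[leb_upto t]_p[EFin \o Pi chi] =
      'N[leb_upto t]_p[EFin \o (fun s => - Pi chi s)%R])%E.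
    by rewrite -(oppe_Lnorm (leb_upto t) (EFin \o Pi chi) p).
  apply.
  exact: measurableT_comp.
rewrite -chiE EFinD ge0_muleDl ?lee_fin// mul1e.
by rewrite leeD2l// PiC.
Qed.

End quasi_optimality.

Section weighted_Hoelder.
Variable R : realType.

(** Hoelder with exponents [q / 2] and [p / 2] is applied to the squared weight and [v^2]; the
    weight contributes at most [(q mu)^(-2/q) <= mu^(-2/q)]. *)
Lemma integral_weight_sqr_le (t mu q : R) (p : \bar R) (v : R -> R) :
  0 < mu -> 2 <= q -> (2%:E < p)%E -> (q%:E^-1 + p^-1 = (2^-1)%:E)%E ->
  measurable_fun setT v ->
  (\int[leb_upto t]_s ((expR (- (mu * (t - s))) * v s) ^+ 2)%:E <=
   (mu `^ (- (2 / q)))%:E * ('N[leb_upto t]_p[EFin \o v] * 'N[leb_upto t]_p[EFin \o v]))%E.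
Proof.
move=> mu0 q2 p2 pq mv.
have q0 : 0 < q by apply: lt_le_trans q2.
have mw (c : R) : measurable_fun setT (fun s : R => expR (- (c * (t - s)))).
  apply: measurableT_comp => //; apply: measurableT_comp => //.
  by apply: measurable_funM => //; exact: measurable_funB.
have wE (s : R) : (expR (- (mu * (t - s))) * v s) ^+ 2 = expR (- (2 * mu * (t - s))) * v s ^+ 2.
  by rewrite exprMn expr2 -expRD; congr (expR _ * _); ring.
under eq_integral do rewrite wE.
case: p p2 pq => [r r2|_|//].
  have r0 : 0 < r by rewrite -lte_fin (lt_trans _ r2)// lte_fin.
  rewrite !inver !gt_eqF// -EFinD => -[qr].
  have := @hoelder _ _ _ (leb_upto t) (fun s => expR (- (2 * mu * (t - s)))) (fun s => v s ^+ 2)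
    (q / 2) (r / 2) (mw _) (measurable_funX _ mv).
  rewrite !divr_gt0// => /(_ isT isT).
  rewrite !invf_div -mulrDr qr mulfV// => /(_ erefl).
  have -> : (\int[leb_upto t]_s (expR (- (2 * mu * (t - s))) * v s ^+ 2)%:E =
      'N[leb_upto t]_1[EFin \o ((fun s => expR (- (2 * mu * (t - s)))) \* (fun s => v s ^+ 2))%R])%E.
    rewrite Lnorm1; apply: eq_integral => s _.
    by rewrite /= ger0_norm// mulr_ge0 ?expR_ge0 ?sqr_ge0.
  move=> /le_trans; apply; rewrite ![in leLHS]unlock.
  have -> : (\int[leb_upto t]_x (`|(EFin \o (fun s : R => v s ^+ 2)%R) x| `^ (r / 2)) =
      \int[leb_upto t]_x (`|(EFin \o v) x| `^ r))%E.
    apply: eq_integral => s _ /=; congr EFin; rewrite ger0_norm ?sqr_ge0//.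
    rewrite -real_normK ?num_real// -powR_mulrn// -powRrM; congr (_ `^ _).
    by rewrite mulrC divfK.
  have -> : (\int[leb_upto t]_x (`|(EFin \o (fun s : R => expR (- (2 * mu * (t - s))))) x| `^ (q / 2)) =
      \int[leb_upto t]_x (expR (- (q * mu * (t - x))))%:E)%E.
    apply: eq_integral => s _ /=; congr EFin; rewrite ger0_norm ?expR_ge0//.
    by rewrite -expRM; congr expR; field.
  rewrite !invf_div (_ : 2 / r = r^-1 + r^-1); last by ring.
  rewrite poweRD; last first.
    by apply: add_neq0_poweRD_def; rewrite gt_eqF// addr_gt0// invr_gt0.
  rewrite [in leRHS]unlock lee_wpmul2r ?mule_ge0 ?poweR_ge0//.
  have c0 : 0 < q * mu by rewrite mulr_gt0.
  apply: (@le_trans _ _ ((mu^-1)%:E `^ (2 / q))%E).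
    apply: gt0_ler_poweR; rewrite ?in_itv/= ?leey ?andbT ?divr_ge0 ?(ltW q0)//.
    - by apply: integral_ge0 => s _; rewrite lee_fin expR_ge0.
    - by rewrite lee_fin invr_ge0 ltW.
    apply: le_trans (integral_expR_upto_le t c0) _.
    rewrite lee_fin lef_pV2 ?posrE// ler_peMl ?(ltW mu0)//.
    by apply: le_trans q2; rewrite ler1n.
  by rewrite poweR_EFin powRN -powR_inv1 ?(ltW mu0)// -powRrM mulN1r powRN.
(* Here [p] is infinite and [q = 2]: the essential supremum is taken out of the integral. For a null
   measure, which occurs at [t = 0], the norm is 0 by convention and so is the integral. *)
rewrite invey adde0 inver gt_eqF// => -[qV].
have {}q2 : 2 / q = 1 by rewrite qV mulfV.
rewrite q2 powRN powRr1 ?(ltW mu0)//.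
rewrite unlock; case: ifPn => [muT|muT]; last first.
  have muT0 : leb_upto t setT = 0%E by apply/eqP; rewrite eq_le measure_ge0 andbT leNgt.
  rewrite null_set_integral ?mul0e ?mule0//; apply/measurable_EFinP.
  by apply: measurable_funM; [exact: mw|exact: measurable_funX].
set S := ess_sup _ _.
have vS : {ae leb_upto t, forall s, (`|v s|%:E <= S)%E}.
  exact: (ess_sup_ge (leb_upto t) (abse \o (EFin \o v))).
have [Soo|Sfin] := eqVneq S +oo%E.
  rewrite Soo mulyy gt0_muley ?leey// lte_fin invr_gt0//.
have S0 : (0 <= S)%E by apply: ess_sup_gee => //; apply: aeW => s /=.
have [c SE] : exists c, S = c%:E by exists (fine S); rewrite fineK// ge0_fin_numE ?ltey.
have c0 : 0 <= c by rewrite -lee_fin -SE.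
apply: (@le_trans _ _ (\int[leb_upto t]_s ((c ^+ 2)%:E * (expR (- (2 * mu * (t - s))))%:E))%E).
  apply: ae_ge0_le_integral => //.
  - by move=> s _; rewrite lee_fin mulr_ge0 ?expR_ge0 ?sqr_ge0.
  - by apply/measurable_EFinP/measurable_funM; [exact: mw|exact: measurable_funX].
  - by move=> s _; rewrite mule_ge0// lee_fin ?sqr_ge0 ?expR_ge0.
  - by apply: measurable_funeM; apply/measurable_EFinP; exact: mw.
  apply: filterS vS => s; rewrite SE !lee_fin => vs _.
  rewrite mulrC ler_wpM2r ?expR_ge0//.
  by rewrite -real_normK ?num_real// lerXn2r ?nnegrE.
rewrite ge0_integralZl//; last 2 first.
- by apply/measurable_EFinP; exact: mw.
- by rewrite lee_fin sqr_ge0.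
have -> : (S * S = (c ^+ 2)%:E)%E by rewrite SE -EFinM.
rewrite [leRHS]muleC lee_wpmul2l ?lee_fin ?sqr_ge0//.
have c1 : 0 < 2 * mu by rewrite mulr_gt0.
apply: le_trans (integral_expR_upto_le t c1) _.
by rewrite lee_fin lef_pV2 ?posrE// ler_peMl ?(ltW mu0)// ler1n.
Qed.

End weighted_Hoelder.

(** * Tails of convergent power series *)

Section tail_sum.
Variable R : realType.

(** The mean value theorem for [x^(1-a)] on [[k, k+1]] yields [c^(-a)] with [c < k + 1]; the
    resulting differences telescope. *)
Lemma powR_tail_term_le (a : R) k : 1 < a -> (0 < k)%N ->
  k.+1%:R `^ (- a) <= (k%:R `^ (1 - a) - k.+1%:R `^ (1 - a)) / (a - 1) :> R.
Proof.
move=> a1 k0; have a0 : 0 < a - 1 by rewrite subr_gt0.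
have k0' : (0 : R) < k%:R by rewrite ltr0n.
have kk : (k%:R : R) < k.+1%:R by rewrite ltr_nat.
have [||c] := @MVT R (fun x => x `^ (1 - a)) (fun x => (1 - a) * x `^ (1 - a - 1)) _ _ kk.
- move=> x; rewrite in_itv/= => /andP[kx _]; apply: is_derive1_powR.
  exact: lt_trans kx.
- apply/subspace_continuousP => y /=; rewrite in_itv/= => /andP[ky _].
  apply: cvg_within_filter; apply/differentiable_continuous/derivable1_diffP.
  by have [] := is_derive1_powR (1 - a) (lt_le_trans k0' ky).
rewrite in_itv/= => /andP[kc ck]; rewrite -natr1 [_ + 1 - _]addrAC subrr add0r mulr1 => E.
have c0 : 0 < c by exact: lt_trans kc.
have -> : k%:R `^ (1 - a) - (k%:R + 1) `^ (1 - a) = (a - 1) * c `^ (- a).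
  by rewrite -opprB E (_ : 1 - a - 1 = - a); ring.
rewrite ler_pdivlMr// mulrC ler_wpM2l ?(ltW a0)//.
rewrite !powRN lef_pV2 ?posrE ?powR_gt0//.
by apply: ge0_ler_powR; rewrite ?nnegrE ?(ltW c0) ?addr_ge0// ?natr1 ?(ltW ck)//; lra.
Qed.

Lemma powR_tail_sum_le (a : R) M : 1 < a -> (0 < M)%N ->
  (\sum_(M <= k <oo) (k.+1%:R `^ (- a) : R)%:E <= (M%:R `^ (1 - a) / (a - 1))%:E)%E.
Proof.
move=> a1 M0; have a0 : 0 < a - 1 by rewrite subr_gt0.
apply: lime_le.
  by apply: is_cvg_nneseries => k _ _; rewrite lee_fin powR_ge0.
near=> n; have Mn : (M <= n)%N by near: n; exact: nbhs_infty_ge.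
rewrite sumEFin lee_fin.
apply: (@le_trans _ _ (\sum_(M <= k < n) (k%:R `^ (1 - a) - k.+1%:R `^ (1 - a)) / (a - 1))).
  rewrite big_nat_cond [leRHS]big_nat_cond; apply: ler_sum => k /andP[/andP[Mk _] _].
  by apply: powR_tail_term_le => //; exact: leq_trans Mk.
rewrite -mulr_suml (@telescope_sumr_eq _ M n (fun k => - k%:R `^ (1 - a)))//; last first.
  by move=> k _; rewrite opprK addrC.
by rewrite ler_wpM2r ?invr_ge0 ?(ltW a0)// opprK addrC gerBl powR_ge0.
Unshelve. all: by end_near. Qed.

End tail_sum.

(** * The error of the full discretisation *)

Section coordinates.
Context d (T : measurableType d) (R : realType) (dO : measure_display).
Variables (mu : {measure set T -> \bar R}) (Omega : measurableType dO).
Variable P : probability Omega R.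

Lemma L2dot_eigenfunction dom (A : (T -> R) -> T -> R) a f :
  eigenfunction mu dom A a f -> L2 mu f -> L2 mu (A f) ->
  L2dot mu (A f) f = a * L2dot mu f f.
Proof.
move=> [_ Af] Lf LAf; rewrite -L2dotZl//; congr fine.
have mf := L2_measurable Lf; have mAf := L2_measurable LAf.
apply: ae_eq_integral => //.
- by apply/measurable_EFinP; exact: measurable_funM.
- by apply/measurable_EFinP; apply: measurable_funM => //; exact: measurable_funM.
- by apply: filterS Af => x /(_ I) -> _.
Qed.

(** Dividing by the square root of [<Q phi, phi>] normalises the variance. Equal times are treated
    apart, as the law of increments is prescribed for [s < r] only. *)
Lemma wiener_coordinate_variance (Q : (T -> R) -> T -> R)
    (W : R -> (T -> R) -> {RV P >-> R}) phi s r :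
  generalised_wiener mu Q W -> L2 mu phi -> 0 < L2dot mu (Q phi) phi -> 0 <= s <= r ->
  (\int[P]_w (((Num.sqrt (L2dot mu (Q phi) phi))^-1 * W r phi w -
    (Num.sqrt (L2dot mu (Q phi) phi))^-1 * W s phi w) ^+ 2)%:E = (r - s)%:E)%E.
Proof.
move=> [_ _ _ WI _] Lphi v0 /andP[s0]; rewrite le_eqVlt => /predU1P[->|sr].
  by rewrite subrr; under eq_integral do rewrite subrr expr0n; rewrite integral0.
set v := L2dot _ _ _ in v0 *.
have := integral_sqr_centered_normal _ _ (WI s r phi s0 sr Lphi).
rewrite -/v => E.
under eq_integral do rewrite -mulrBr exprMn exprVn sqr_sqrtr ?(ltW v0)// EFinM.
rewrite ge0_integralZl//; last 3 first.
- by apply/measurable_EFinP/measurable_funX/measurable_funB.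
- by move=> x _; rewrite lee_fin sqr_ge0.
- by rewrite lee_fin invr_ge0 ltW.
rewrite E -?EFinM; last 2 first.
- exact: measurable_funB.
- by rewrite mulr_ge0 ?subr_ge0// ltW.
by congr EFin; field; rewrite gt_eqF.
Qed.

End coordinates.

Section full_discretisation.
Context d (T : measurableType d) (R : realType) (dO : measure_display).
Variables (muD : {measure set T -> \bar R}) (Omega : measurableType dO).
Variables (P : probability Omega R) (gamma t : R) (e : nat -> T -> R).
Variables (mu lambda : nat -> R) (B : nat -> R -> Omega -> R) (f' : R -> R).
Variables (I I' : nat -> Omega -> R) (X : Omega -> T -> R).
Hypotheses (g12 : 2^-1 < gamma) (t0 : 0 <= t) (onb : orthonormal_basis muD e).
Hypotheses (mu0 : forall k, 0 < mu k) (lambda0 : forall k, 0 < lambda k).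
Hypothesis mB : forall k s, measurable_fun setT (B k s).
Hypothesis varB : forall k (s r : R), 0 <= s <= r ->
  (\int[P]_w ((B k r w - B k s w) ^+ 2)%:E = (r - s)%:E)%E.
Hypothesis II : forall k, is_wiener_integral P (B k) t
  (fun s => expR (- (mu k * (t - s))) * power_kernel gamma t s) (I k).
Hypothesis II' : forall k, is_wiener_integral P (B k) t
  (fun s => expR (- (mu k * (t - s))) * f' s) (I' k).
Let c k w := Num.sqrt (lambda k) / Gamma gamma * I k w.
Let c' k w := Num.sqrt (lambda k) / Gamma gamma * I' k w.
Hypothesis XP : is_L2_series P muD c e X.

Let mI k : measurable_fun setT (I k).
Proof. by have [_ /L2_measurable] := II k. Qed.

Let mI' k : measurable_fun setT (I' k).
Proof. by have [_ /L2_measurable] := II' k. Qed.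

Let scaled_sqr_le k (Y : Omega -> R) (g : R -> R) (b : R) : measurable_fun setT Y ->
  (L2norm P Y <= L2norm (leb_upto t) g)%E ->
  (\int[leb_upto t]_s (g s ^+ 2)%:E <= b%:E)%E ->
  (\int[P]_w ((Num.sqrt (lambda k) / Gamma gamma * Y w) ^+ 2)%:E <=
   ((Gamma gamma ^+ 2)^-1 * (lambda k * b))%:E)%E.
Proof.
move=> mY Yg gb.
have c0 : 0 <= (Gamma gamma ^+ 2)^-1 * lambda k.
  by rewrite mulr_ge0 ?invr_ge0 ?sqr_ge0// ltW.
under eq_integral do rewrite exprMn expr_div_n sqr_sqrtr ?(ltW (lambda0 k))//
  [lambda k / _]mulrC EFinM.
rewrite ge0_integralZl//; last 2 first.
- by apply/measurable_EFinP; exact: measurable_funX.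
- by move=> x _; rewrite lee_fin sqr_ge0.
rewrite mulrA [leRHS]EFinM lee_wpmul2l ?lee_fin//; apply: le_trans gb.
by rewrite -!L2norm_sqr; apply: lee_pmul => //; exact: L2norm_ge0.
Qed.

Lemma integral_coefficient_le k :
  (\int[P]_w (c k w ^+ 2)%:E <= ((Gamma gamma ^+ 2)^-1 *
     (lambda k * (Gamma (2 * gamma - 1) * mu k `^ (- (2 * gamma - 1)))))%:E)%E.
Proof.
have le_II := wiener_integral_le (mB k) (varB k) t0 (II k).
exact (scaled_sqr_le k (mI k) le_II (integral_kernel_Gamma_le t g12 (mu0 k))).
Qed.

Lemma integral_coefficient_error_le k b :
  (\int[leb_upto t]_s ((expR (- (mu k * (t - s))) * (power_kernel gamma t s - f' s)) ^+ 2)%:E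
    <= b%:E)%E ->
  (\int[P]_w ((c k w - c' k w) ^+ 2)%:E <= ((Gamma gamma ^+ 2)^-1 * (lambda k * b))%:E)%E.
Proof.
move=> bP; under eq_integral do rewrite -mulrBr.
have := wiener_integralB_le (mB k) (varB k) (II k) (II' k).
under [X in (_ <= L2norm _ X)%E -> _]eq_fun do rewrite -mulrBr.
move=> le_II; exact (scaled_sqr_le k (measurable_funB (mI k) (mI' k)) le_II bP).
Qed.

Variables (r_mu C1 r_lambda C2 : R).
Hypotheses (C10 : 0 < C1) (muP : forall k, C1 * k.+1%:R `^ r_mu <= mu k).
Hypotheses (C20 : 0 < C2) (lambdaP : forall k, lambda k <= C2 * k.+1%:R `^ r_lambda).
Hypothesis r1 : 1 + r_lambda - (2 * gamma - 1) * r_mu < 0.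
Let a := (2 * gamma - 1) * r_mu - r_lambda.

(** The exponent of [mu k] is negative, so its lower bound gives an upper bound; the two rates
    combine into [- a], and [r1] says that [a > 1]. *)
Lemma truncation_term_le k :
  lambda k * (Gamma (2 * gamma - 1) * mu k `^ (- (2 * gamma - 1))) <=
  C2 * Gamma (2 * gamma - 1) / C1 `^ (2 * gamma - 1) * k.+1%:R `^ (- a).
Proof.
have g0 : 0 <= 2 * gamma - 1 by rewrite subr_ge0 -ler_pdivrMl// mulr1 ltW.
have k0 : (0 : R) < k.+1%:R `^ r_mu by rewrite powR_gt0.
have -> : C2 * Gamma (2 * gamma - 1) / C1 `^ (2 * gamma - 1) * k.+1%:R `^ (- a) =
    (C2 * k.+1%:R `^ r_lambda) * (Gamma (2 * gamma - 1) *
      (C1 * k.+1%:R `^ r_mu) `^ (- (2 * gamma - 1))).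
  rewrite powRM ?(ltW C10) ?(ltW k0)// [C1 `^ (- _)]powRN -powRrM.
  have -> : - a = r_lambda + r_mu * - (2 * gamma - 1) by rewrite /a; ring.
  by rewrite powRD ?pnatr_eq0 ?implybT//; ring.
apply: ler_pM; rewrite ?(ltW (lambda0 k)) ?mulr_ge0 ?Gamma_ge0 ?powR_ge0//.
rewrite ler_wpM2l ?Gamma_ge0// !powRN lef_pV2 ?posrE ?powR_gt0 ?mulr_gt0//.
by apply: ge0_ler_powR; rewrite ?nnegrE ?mulr_ge0 ?(ltW C10) ?powR_ge0 ?(ltW (mu0 k)).
Qed.

Lemma full_error_le M (b : nat -> R) : (0 < M)%N ->
  (forall k, (k < M)%N -> (\int[leb_upto t]_s
    ((expR (- (mu k * (t - s))) * (power_kernel gamma t s - f' s)) ^+ 2)%:E <= (b k)%:E)%E) ->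
  (mean_sq_norm P muD (fun w x => X w x - \sum_(k < M) c' k w * e k x)%R <=
   (C2 * Gamma (2 * gamma - 1) / (C1 `^ (2 * gamma - 1) * Gamma gamma ^+ 2 * (a - 1)) *
      M%:R `^ (1 - a) + (Gamma gamma ^+ 2)^-1 * \sum_(k < M) lambda k * b k)%:E)%E.
Proof.
move=> M0 bP; have [LX mX _] := XP.
have mc k : measurable_fun setT (c k) by exact: measurable_funM.
have mc' k : measurable_fun setT (c' k) by exact: measurable_funM.
rewrite (L2_series_error onb LX mX _ mc mc' XP) (nneseries_split _ M); last first.
  by move=> k _; exact: integral_sqr_ge0.
rewrite addeC EFinD add0n; apply: leeD.
  pose D := (Gamma gamma ^+ 2)^-1 * (C2 * Gamma (2 * gamma - 1) / C1 `^ (2 * gamma - 1)).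
  have D0 : 0 <= D.
    by rewrite !mulr_ge0 ?invr_ge0 ?sqr_ge0 ?powR_ge0 ?Gamma_ge0// ltW.
  apply: (@le_trans _ _ (\sum_(M <= k <oo) (D%:E * (k.+1%:R `^ (- a) : R)%:E))%E).
    rewrite eseries_cond [leRHS]eseries_cond; apply: lee_nneseries => k.
      by move=> _ _; exact: integral_sqr_ge0.
    rewrite andTb => Mk; rewrite ltnNge Mk.
    under eq_integral do rewrite mul0r subr0.
    apply: le_trans (integral_coefficient_le k) _.
    rewrite -EFinM lee_fin /D -[leRHS]mulrA.
    by rewrite ler_wpM2l ?invr_ge0 ?sqr_ge0// truncation_term_le.
  rewrite nneseriesZl; last by move=> k _; rewrite lee_fin powR_ge0.
  apply: (@le_trans _ _ (D%:E * (M%:R `^ (1 - a) / (a - 1))%:E)%E).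
    rewrite lee_wpmul2l ?lee_fin// powR_tail_sum_le// -subr_gt0 -oppr_lt0.
    by rewrite (_ : - (a - 1) = 1 + r_lambda - (2 * gamma - 1) * r_mu)// /a; ring.
  rewrite -EFinM lee_fin /D !invfM le_eqVlt; apply/orP; left; apply/eqP; ring.
rewrite mulr_sumr -sumEFin big_mkord; apply: lee_sum => -[k kM] _ /=.
rewrite kM; under eq_integral do rewrite mul1r.
exact: integral_coefficient_error_le (bP k kM).
Qed.

End full_discretisation.

(** The condition on [gamma] reads [-1/p < gamma - m - 2], that is, [x^(gamma - m - 2)] has finite
    [L^p] norm at 0. *)
Lemma power_kernel_Lnorm_approx (R : realType) (gamma t : R) (m : nat) (q : R) :
  exists2 D : R, 0 <= D & forall (p : \bar R) T N (tau : nat -> R),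
    2 <= q -> (2%:E < p)%E -> (q%:E^-1 + p^-1 = (2^-1)%:E)%E ->
    m%:R + 3 / 2 + q^-1 < gamma -> 0 < T -> 0 <= t <= T -> mesh T N tau ->
  exists2 g : R -> R, piecewise_poly t m N tau g &
    ('N[leb_upto t]_p[EFin \o (fun s => power_kernel gamma t s - g s)%R] <=
     (D * mesh_size N tau ^+ m.+1)%:E)%E.
Proof.
have [K K0 HK] := power_kernel_approx m gamma.
(* [r] is the finite value of [p] expressed through [q], so that the constant is fixed before [p];
   [q = 2] stands for infinite [p]. *)
pose e := gamma - 1 - m.+1%:R; pose r := (2^-1 - q^-1)^-1.
pose c := if q == 2 then t `^ e else (t `^ (e * r + 1) / (e * r + 1)) `^ r^-1.
have c0 : 0 <= c by rewrite /c; case: ifP => _; exact: powR_ge0.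
exists (K * c); first exact: mulr_ge0.
move=> p T N tau q2 p2 pq gq T0 /andP[t0 tT] tauP.
have q0 : 0 < q by apply: lt_le_trans q2.
have qV : 0 < q^-1 by rewrite invr_gt0.
have [g [mg gqP gP]] := HK T t N tau T0 tT tauP.
have eq_e : q^-1 - 2^-1 < e.
  by rewrite /e -[m.+1%:R]natr1; lra.
exists g.
  split.
    apply: (L2_mesh_approx T0 t0 tauP K0 mg gP).
    apply: le_lt_trans gq; have : (0 : R) <= m%:R by []. lra.
  move=> l lN; have [u su uP] := gqP l lN; exists u => //.
  by apply: aeW => s sl st; exact: uP.
rewrite -mulrA [c * _]mulrC mulrA /c.
case: p p2 pq => [r'|_|//].
  rewrite lte_fin => r'2; have r'0 : 0 < r' by apply: lt_trans r'2.
  rewrite !inver (gt_eqF q0) (gt_eqF r'0) -EFinD => -[pq].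
  have rE : r = r' by rewrite /r -pq addrC addKr invrK.
  have -> : (q == 2) = false.
    apply/negbTE/eqP => q2E; move: pq; rewrite q2E => /(canRL (addKr _)).
    by rewrite addNr => /eqP; rewrite invr_eq0 gt_eqF.
  rewrite rE; apply: (Lnorm_mesh_error_le T0 t0 tauP K0 mg gP).
    by apply: le_trans (ltW r'2); rewrite ler1n.
  rewrite -ltrBlDr sub0r -ltr_pdivrMr// mulN1r; apply: le_lt_trans eq_e.
  by rewrite -pq opprD addNKr.
rewrite invey adde0 inver (gt_eqF q0) => -[pq].
have -> : q == 2 by rewrite -(inj_eq invr_inj) pq.
apply: (Linfty_mesh_error_le T0 t0 tauP K0 gP).
by rewrite pq subrr in eq_e.
Qed.

(* The basis is indexed from 0: [e k], [mu k], [lambda k] are those of index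
   k.+1 in one-based numbering. *)
Theorem theorem3p14 (R : realType) :
  exists (C : R -> R -> R -> R) (C' : R -> R -> R -> nat -> R -> R),
  forall (gamma T t : R) (m : nat),
    2^-1 < gamma -> 0 < T -> 0 <= t <= T ->
  forall (d : nat) (D : set (d.-tuple (measurableTypeR R)))
    (mD : measurable D),
    (0 < d)%N ->
  let muD := mrestr (tuple_lebesgue R d) mD in
  forall (domA : set (d.-tuple (measurableTypeR R) -> R))
    (A Q : (d.-tuple (measurableTypeR R) -> R) ->
           d.-tuple (measurableTypeR R) -> R)
    (e : nat -> d.-tuple (measurableTypeR R) -> R) (mu lambda : nat -> R),
    linear_operator muD domA A ->
    linear_operator muD (L2 muD) Q ->
    orthonormal_basis muD e ->
    (forall k, eigenfunction muD domA A (mu k) (e k)) ->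
    (forall k, eigenfunction muD (L2 muD) Q (lambda k) (e k)) ->
    (forall k, mu k <= mu k.+1) ->
    (forall k, lambda k.+1 <= lambda k) ->
  forall r_mu C1 r_lambda C2 : R,
    0 < r_mu -> 0 < C1 -> (forall k, C1 * k.+1%:R `^ r_mu <= mu k) ->
    r_lambda < 0 -> 0 < C2 ->
    (forall k, 0 < lambda k <= C2 * k.+1%:R `^ r_lambda) ->
    1 + r_lambda - (2 * gamma - 1) * r_mu < 0 ->
  forall (N : nat) (tau : nat -> R) (domPi : set (R -> R))
    (Pi : (R -> R) -> R -> R) (CPi : R),
    mesh T N tau ->
    linear_operator (leb_upto t) domPi Pi ->
    (forall chi, domPi chi -> piecewise_poly t m N tau (Pi chi)) ->
    (forall g, piecewise_poly t m N tau g -> Pi g = g %[ae leb_upto t]) ->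
    approx_space gamma t m N tau `<=` domPi ->
    0 < CPi ->
    (forall chi, approx_space gamma t m N tau chi ->
      (L2norm (leb_upto t) (Pi chi) <= CPi%:E * L2norm (leb_upto t) chi)%E) ->
  forall (dO : measure_display) (Omega : measurableType dO)
    (P : probability Omega R)
    (W : R -> (d.-tuple (measurableTypeR R) -> R) -> {RV P >-> R})
    (I I' : nat -> Omega -> R)
    (X : Omega -> d.-tuple (measurableTypeR R) -> R) (M : nat),
    generalised_wiener muD Q W ->
  let omega k s w := (Num.sqrt (lambda k))^-1 * W s (e k) w in
    (forall k, is_wiener_integral P (omega k) t
      (fun s => expR (- (mu k * (t - s))) * power_kernel gamma t s) (I k)) ->
    (forall k, is_wiener_integral P (omega k) t
      (fun s => expR (- (mu k * (t - s))) * Pi (power_kernel gamma t) s)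
      (I' k)) ->
  let c k w := Num.sqrt (lambda k) / Gamma gamma * I k w in
  let c' k w := Num.sqrt (lambda k) / Gamma gamma * I' k w in
  let XM w x := \sum_(k < M) c' k w * e k x in
    is_L2_series P muD c e X ->
    (0 < M)%N ->
  let h := mesh_size N tau in
  let nu := - (d%:R / 2) * (1 + r_lambda - (2 * gamma - 1) * r_mu) in
  let Ctail := C2 * Gamma (2 * gamma - 1) /
    (C1 `^ (2 * gamma - 1) * Gamma gamma ^+ 2 *
     ((2 * gamma - 1) * r_mu - r_lambda - 1)) in
  let bound CM := Ctail * M%:R `^ (- (2 * nu / d%:R)) +
    CM * delta gamma m t h ^+ 2 *
      h `^ Num.min (2 * gamma - 1) (2 * m + 2)%:R in
  let error := mean_sq_norm P muD (fun w x => X w x - XM w x) in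
    (error <= (bound (C CPi t gamma * \sum_(k < M) lambda k))%:E)%E /\
    forall (q : R) (p : \bar R) (CPip : R),
      2 <= q -> (2%:E < p)%E -> (q%:E^-1 + p^-1 = (2^-1)%:E)%E ->
      m%:R + 3 / 2 + q^-1 < gamma ->
      0 < CPip ->
      (forall chi, approx_space gamma t m N tau chi ->
        ('N[leb_upto t]_p[EFin \o Pi chi] <=
         CPip%:E * 'N[leb_upto t]_p[EFin \o chi])%E) ->
      (error <= (bound (C' CPip t gamma m q / Gamma gamma ^+ 2 *
        \sum_(k < M) mu k `^ (- (2 / q)) * lambda k))%:E)%E.
Proof.
pose K g t := s2val (cid2 (@power_kernel_L2_approx R g t)).
pose D g t m q := s2val (cid2 (@power_kernel_Lnorm_approx R g t m q)).
(* [1 + C] is the quasi-optimality factor of the projection; it is squared because the error is a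
   mean square. *)
exists (fun C t g => (1 + C) ^+ 2 * K g t / Gamma g ^+ 2),
  (fun C t g m q => ((1 + C) * D g t m q) ^+ 2).
move=> gamma T t m g12 T0 tT d D0 mD d0 muD domA A Q e mu lambda _ [[_ LQ] _ _ _ _] onb _ eigQ _ _
  r_mu C1 r_lambda C2 _ C10 muP _ C20 lambdaP r1 N tau domPi Pi CPi tauP linPi Pi_poly Pi_id
  dom_approx CPi0 PiC dO Omega P W I I' X M WQ omega II II' c c' XM XP M0 h nu Ctail bound error.
have t0 : 0 <= t by case/andP: tT.
have mu0 k : 0 < mu k by apply: lt_le_trans (muP k); rewrite mulr_gt0// powR_gt0.
have lambda0 k : 0 < lambda k by case/andP: (lambdaP k).
have varQ k : L2dot muD (Q (e k)) (e k) = lambda k.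
  have Le := L2_basis onb k.
  rewrite (L2dot_eigenfunction (eigQ k) Le (LQ _ Le)) (L2dot_basis onb).
  by rewrite eqxx mulr1.
have momega k s : measurable_fun setT (omega k s) by exact: measurable_funM.
have varomega k (s r : R) : 0 <= s <= r ->
    (\int[P]_w ((omega k r w - omega k s w) ^+ 2)%:E = (r - s)%:E)%E.
  move=> sr; have := wiener_coordinate_variance WQ (L2_basis onb k) _ sr.
  by rewrite varQ; exact.
pose w k (s : R) := expR (- (mu k * (t - s))).
have mw k : measurable_fun setT (w k).
  apply: measurableT_comp => //; apply: measurableT_comp => //.
  by apply: measurable_funM => //; exact: measurable_funB.
have h0 : 0 < h := mesh_size_gt0 T0 tauP.
pose r s := power_kernel gamma t s - Pi (power_kernel gamma t) s.
have mr : measurable_fun setT r.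
  apply: measurable_funB; first exact: measurable_power_kernel.
  exact: L2_measurable (L2_projection Pi_poly dom_approx).
have d1 : - (2 * nu / d%:R) = 1 - ((2 * gamma - 1) * r_mu - r_lambda).
  by rewrite /nu; field; rewrite pnatr_eq0 -lt0n.
(* The two bounds differ only in the estimate [b k] of the weighted projection error of mode [k]. *)
have main (b : nat -> R) CM :
    (forall k, (\int[leb_upto t]_s ((w k s * r s) ^+ 2)%:E <= (b k)%:E)%E) ->
    (Gamma gamma ^+ 2)^-1 * (\sum_(k < M) lambda k * b k) =
      CM * delta gamma m t h ^+ 2 * h `^ minr (2 * gamma - 1) (2 * m + 2)%:R ->
    (error <= (bound CM)%:E)%E.
  move=> bP bE; rewrite /bound -bE d1.
  have lambdaP' k : lambda k <= C2 * k.+1%:R `^ r_lambda by case/andP: (lambdaP k).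
  exact: (full_error_le g12 t0 onb mu0 lambda0 momega varomega II II' XP C10 muP C20
    lambdaP' r1 M0 (fun k _ => bP k)).
split.
  (* The exponential weight is at most 1 on [[0, t)], so one value serves all modes. *)
  pose B := (1 + CPi) ^+ 2 * (K gamma t * delta gamma m t h ^+ 2 *
    h `^ minr (2 * gamma - 1) (2 * m + 2)%:R).
  apply: (main (fun=> B)); last by rewrite -mulr_suml /B; ring.
  move=> k; apply: (@le_trans _ _ (\int[leb_upto t]_s (r s ^+ 2)%:E)%E).
    apply: le_integral_leb_upto; try by move=> s; exact: sqr_ge0.
    - by apply: measurable_funX; exact: measurable_funM.
    - exact: measurable_funX.
    move=> s /andP[s0 s_t]; rewrite exprMn ler_piMl ?sqr_ge0// expr_le1 ?expR_ge0//.
    by rewrite -[leRHS]expR0 ler_expR oppr_le0 mulr_ge0 ?(ltW (mu0 k))// subr_ge0 ltW.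
  have p1 : (1 <= 2%:E :> \bar R)%E by rewrite lee_fin ler1n.
  have [g gP gB] := s2valP' (cid2 (power_kernel_L2_approx gamma t)) T m N tau g12 T0 tT tauP.
  apply: (@le_trans _ _ (((1 + CPi) ^+ 2)%:E *
      \int[leb_upto t]_s ((power_kernel gamma t s - g s) ^+ 2)%:E)%E).
    rewrite -!L2norm_sqr expr2 EFinM muleACA; apply: lee_pmul; rewrite ?L2norm_ge0//.
      exact: (projection_error_le linPi Pi_poly Pi_id dom_approx p1 (ltW CPi0) PiC gP).
    exact: (projection_error_le linPi Pi_poly Pi_id dom_approx p1 (ltW CPi0) PiC gP).
  by rewrite /B [leRHS]EFinM lee_wpmul2l ?lee_fin ?sqr_ge0.
move=> q p CPip q2 p2 pq gq CPip0 PiCp.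
have q0 : 0 < q by apply: lt_le_trans q2.
have qV : 0 < q^-1 by rewrite invr_gt0.
have gm : m%:R + 3 / 2 < gamma by apply: lt_trans gq; rewrite ltrDl.
apply: (main (fun k => mu k `^ (- (2 / q)) * ((1 + CPip) * D gamma t m q * h ^+ m.+1) ^+ 2)); last first.
  (* Since [gamma > m + 3/2], the logarithmic factor is absent and the minimum is [2 m + 2], the
     square of the rate [h^(m+1)]. *)
  rewrite /delta gt_eqF// expr1n mulr1 (min_idPr _); last first.
    by rewrite natrD natrM; move: gm; clear; move: (m%:R : R) => n; lra.
  rewrite powR_mulrn ?(ltW h0)// !mulr_sumr mulr_suml; apply: eq_bigr => k _.
  rewrite [_ ^+ (2 * m + 2)](_ : _ = (h ^+ m.+1) ^+ 2); last first.
    by rewrite -exprM [(m.+1 * 2)%N]mulnC mulnS addnC.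
  by rewrite /= !exprMn; ring.
move=> k; have p1 : (1 <= p)%E by apply: le_trans (ltW p2); rewrite lee_fin ler1n.
have [g gP gB] := s2valP' (cid2 (power_kernel_Lnorm_approx gamma t m q)) p T N tau q2 p2 pq gq T0 tT tauP.
have rB : ('N[leb_upto t]_p[EFin \o r] <= ((1 + CPip) * D gamma t m q * h ^+ m.+1)%:E)%E.
  apply: le_trans (projection_error_le linPi Pi_poly Pi_id dom_approx p1 (ltW CPip0) PiCp gP) _.
  by rewrite -mulrA [leRHS]EFinM lee_wpmul2l// lee_fin addr_ge0// ltW.
apply: le_trans (integral_weight_sqr_le t (mu0 k) q2 p2 pq mr) _.
rewrite [leRHS]EFinM lee_wpmul2l ?lee_fin ?powR_ge0// expr2 EFinM.
by apply: lee_pmul; rewrite ?Lnorm_ge0.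
Qed.
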